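(* Let $m<M$ be positive real numbers, let $A_j,B_j$ $(1\le j\le n)$ be positive invertible bounded operators on a complex Hilbert space $\mathscr H$ with $mA_j\le B_j\le MA_j$ for all $1\le j\le n$, and let $\sigma$ be an operator mean with representing function $f$ and dual $\sigma^\perp$. Put $$\mu_f=\frac{f(M)-f(m)}{M-m},\qquad \nu_f=\frac{Mf(m)-mf(M)}{M-m},$$ $$\gamma=\max_{m\le t\le M}\frac{f(t)}{\mu_f t+\nu_f},\qquad \zeta=\max_{m\le t\le M}\frac{f(M)f(m)\,t}{f(t)\,(\nu_f t+Mm\mu_f)}.$$ Then $$\sqrt{\gamma\zeta}\left[\left(\sum_{j=1}^n A_j\,\sigma\, B_j\right)\sharp\left(\sum_{j=1}^n A_j\,\sigma^{\perp} B_j\right)\right]\ \ge\ \left(\sum_{j=1}^n A_j\right)\sharp\left(\sum_{j=1}^n B_j\right).$$ In addition, $$\frac{\sqrt{M}+\sqrt{m}}{2\sqrt[4]{Mm}}\sum_{j=1}^n (A_j\sharp B_j)\ \ge\ \left(\sum_{j=1}^n A_j\,\sigma\, B_j\right)\sharp\left(\sum_{j=1}^n A_j\,\sigma^{\perp} B_j\right).$$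
   Context: For self-adjoint bounded operators, $X\le Y$ means that $Y-X$ is positive, i.e. $\langle (Y-X)x,x\rangle\ge 0$ for all $x$. A real function $f$ on an interval $J$ is operator monotone if $X\le Y$ implies $f(X)\le f(Y)$ for all self-adjoint operators $X,Y$ with spectra in $J$. An operator mean (in the sense of Kubo and Ando) is a binary operation $\sigma$ on positive invertible operators such that (i) $A\le C$, $B\le D$ imply $A\sigma B\le C\sigma D$; (ii) $A_k\downarrow A$, $B_k\downarrow B$ (decreasing, strong operator convergence) imply $A_k\sigma B_k\downarrow A\sigma B$; (iii) $T^*(A\sigma B)T\le (T^*AT)\sigma(T^*BT)$; and $I\sigma I=I$. Operator means correspond bijectively to positive operator monotone functions $f$ on $(0,\infty)$ with $f(1)=1$ through $f(t)I=I\sigma(tI)$ for $t>0$, and then $A\sigma B=A^{1/2}f(A^{-1/2}BA^{-1/2})A^{1/2}$ for positive invertible $A,B$; $f$ is called the representing function of $\sigma$. The dual $\sigma^\perp$ of $\sigma$ is the operator mean with representing function $t/f(t)$. The geometric mean is $A\sharp B=A^{1/2}(A^{-1/2}BA^{-1/2})^{1/2}A^{1/2}$. *)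

(* Defs.v *)
From mathcomp Require Import all_boot all_order all_algebra.
From mathcomp Require Import complex.
From mathcomp Require Import all_classical all_reals all_analysis.

Set Implicit Arguments.
Unset Strict Implicit.
Unset Printing Implicit Defensive.

Import Order.TTheory GRing.Theory Num.Theory.
Import numFieldNormedType.Exports.

Local Open Scope classical_set_scope.
Local Open Scope ring_scope.
Local Open Scope complex_scope.

(* Inner product: linear in the first argument, conjugate-linear in the
   second. *)
Record hilbertType (R : realType) := Hilbert {
  hilbert_space :> completeNormedModType R[i];
  hdot : {dot hilbert_space for Num.conj};
  hdot_norm : forall x, hdot x x = `|x| ^+ 2 }.

(* Operators are plain functions [H -> H], with [bounded_op] as a side
   condition; sums and scalings are the pointwise ones. Operators produced by a
   choice ([xget]) take the junk value [0] when no witness exists. *)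
Section Operators.
Context {R : realType} {H : hilbertType R}.
Implicit Types A B S T X Y : H -> H.

Definition bounded_op T : Prop := linear T /\ continuous T.

Definition adjoint_op T T' : Prop :=
  forall x y, hdot H (T x) y = hdot H x (T' y).

(* On [R[i]], [0 <= z] says that [z] is real and nonnegative. *)
Definition op_le X Y : Prop := forall x, 0 <= hdot H ((Y - X) x) x.

Definition pos_op A : Prop := bounded_op A /\ op_le 0 A.

Definition inverse_op A B : Prop :=
  [/\ bounded_op B, A \o B = idfun & B \o A = idfun].

Definition pos_inv_op A : Prop := pos_op A /\ exists B, inverse_op A B.

Definition op_inv A : H -> H := xget 0 [set B | inverse_op A B].

Definition op_sqrt A : H -> H := xget 0 [set S | pos_op S /\ S \o S = A].

Definition geom_mean A B : H -> H :=
  let S := op_sqrt A in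
  let V := op_inv S in
  S \o op_sqrt (V \o B \o V) \o S.

Definition decreases_to (A_ : nat -> H -> H) A : Prop :=
  (forall k, op_le (A_ k.+1) (A_ k)) /\
  (forall x, A_ k x @[k --> \oo] --> A x).

End Operators.

(* The axioms on one Hilbert space. In the transformer inequality [T] ranges
   over the bounded operators for which both sides are defined. *)
Record operator_mean_on (R : realType) (H : hilbertType R)
    (sigma : (H -> H) -> (H -> H) -> H -> H) : Prop := OperatorMeanOn {
  mean_pos_inv : forall A B, pos_inv_op A -> pos_inv_op B ->
    pos_inv_op (sigma A B);
  mean_monotone : forall A B C D,
    pos_inv_op A -> pos_inv_op B -> pos_inv_op C -> pos_inv_op D ->
    op_le A C -> op_le B D -> op_le (sigma A B) (sigma C D);
  mean_continuous : forall (A_ B_ : nat -> H -> H) A B,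
    (forall k, pos_inv_op (A_ k)) -> (forall k, pos_inv_op (B_ k)) ->
    pos_inv_op A -> pos_inv_op B ->
    decreases_to A_ A -> decreases_to B_ B ->
    decreases_to (fun k => sigma (A_ k) (B_ k)) (sigma A B);
  mean_transformer : forall A B T T',
    pos_inv_op A -> pos_inv_op B ->
    bounded_op T -> bounded_op T' -> adjoint_op T T' ->
    pos_inv_op (T' \o A \o T) -> pos_inv_op (T' \o B \o T) ->
    op_le (T' \o sigma A B \o T) (sigma (T' \o A \o T) (T' \o B \o T));
  mean_id : sigma idfun idfun = idfun }.

(* A mean acts on the operators of every Hilbert space at once, with one common
   representing function. On a single finite-dimensional space the axioms would
   not force the representing function to be operator monotone. *)
Definition mean_operation (R : realType) : Type :=
  forall H : hilbertType R, (H -> H) -> (H -> H) -> H -> H.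

Definition operator_mean (R : realType) (sigma : mean_operation R) : Prop :=
  forall H : hilbertType R, operator_mean_on (@sigma H).

Definition representing_function (R : realType) (sigma : mean_operation R)
    (f : R -> R) : Prop :=
  forall (H : hilbertType R) (t : R), 0 < t ->
    sigma H idfun (t%:C *: idfun) = (f t)%:C *: idfun.

Definition is_dual_mean (R : realType) (tau : mean_operation R)
    (f : R -> R) : Prop :=
  operator_mean tau /\ representing_function tau (fun t => t / f t).

(* [max_on a b g] is the greatest value of [g] on [a, b] (0 if there is none). *)
Definition max_on (R : realType) (a b : R) (g : R -> R) : R :=
  xget 0 [set y | (exists2 t, a <= t <= b & y = g t) /\
                  (forall t, a <= t <= b -> g t <= y)].

Section Constants.
Context {R : realType}.
Variables (m M : R) (f : R -> R).

Definition mu_ : R := (f M - f m) / (M - m).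
Definition nu_ : R := (M * f m - m * f M) / (M - m).
Definition gamma_ : R := max_on m M (fun t => f t / (mu_ * t + nu_)).
Definition zeta_ : R :=
  max_on m M (fun t => f M * f m * t / (f t * (nu_ * t + M * m * mu_))).

End Constants.

(* Main.v *)
(* Write A sigma B = A^(1/2) (I sigma E) A^(1/2) with E = A^(-1/2) B A^(-1/2).
  If
   P is a spectral projection of E on whose range s <= E <= t, comparing E with
   multiples of (P + c (1 - P))^2, on which sigma is known by congruence
   invariance, gives f(s) P <= (I sigma E) P <= f(t) P.  Hence linear
   inequalities between f, t / f(t), sqrt t and affine functions on [m, M] pass
   to the corresponding means, by cutting the spectrum into small pieces.

   The geometric mean A # B is the largest Z for which [[A, Z], [Z, B]] is
   positive.  For the first inequality, f is concave (conjugate diag(m, M) on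
   H + H by a reflection), so sum A sigma B >= mu b + nu a with a = sum A and
   b = sum B; with the same bound for the dual mean, adding multiples of
   [[a, G], [G, b]] and [[b, G], [G, a]], G = a # b, bounds a # b by a multiple
   of the other geometric mean.  The multiple is at most sqrt(gamma zeta), as
   one sees from the values at t = sqrt(m M) of the functions maximized in gamma
   and zeta.  For the second, f and t / f(t) are nondecreasing, so
   sqrt t / f(t) stays in an interval [al, be] with be / al = sqrt(M / m); then
   (sqrt t - al f) (be f - sqrt t) >= 0 gives a linear lower bound of A # B, and
   the arithmetic-geometric mean inequality concludes. *)
From HB Require Import structures.
Require Import Defs.
From mathcomp Require Import all_boot all_order all_algebra.
From mathcomp Require Import complex.
From mathcomp Require Import all_classical all_reals all_analysis.
From mathcomp Require Import ring lra.
Import Order.TTheory GRing.Theory Num.Theory.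
Import numFieldNormedType.Exports.
Local Open Scope ring_scope.
Local Open Scope complex_scope.

Set Implicit Arguments.
Unset Strict Implicit.
Unset Printing Implicit Defensive.

(** * The real inner product *)

Section RealStructure.
Context {R : realType} {H : hilbertType R}.
Implicit Types (x y z : H) (a b c : R) (S T A B : H -> H).

Definition rdot x y : R := complex.Re (hdot H x y).
Definition nr x : R := complex.Re `|x|.

Lemma Re_conj (z : R[i]) : complex.Re (Num.conj z) = complex.Re z.
Proof. by case: z. Qed.

Lemma rdotC x y : rdot x y = rdot y x.
Proof. by rewrite /rdot hermC expr0 mul1r; exact: Re_conj. Qed.

Lemma rdotDl x y z : rdot (x + y) z = rdot x z + rdot y z.
Proof. by rewrite /rdot linearDl raddfD. Qed.

Lemma rdotZl a x y : rdot (a%:C *: x) y = a * rdot x y.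
Proof.
rewrite /rdot linearZl_LR /=; case: (hdot H x y) => u v /=.
by rewrite mul0r subr0.
Qed.

Lemma rdotNl x y : rdot (- x) y = - rdot x y.
Proof. by rewrite /rdot linearNl raddfN. Qed.

Lemma rdotDr x y z : rdot x (y + z) = rdot x y + rdot x z.
Proof. by rewrite rdotC rdotDl !(rdotC _ x). Qed.

Lemma rdotZr a x y : rdot x (a%:C *: y) = a * rdot x y.
Proof. by rewrite rdotC rdotZl rdotC. Qed.

Lemma rdotNr x y : rdot x (- y) = - rdot x y.
Proof. by rewrite rdotC rdotNl rdotC. Qed.

Lemma rdot0l x : rdot 0 x = 0.
Proof. by rewrite -[0](subrr x) rdotDl rdotNl subrr. Qed.

Lemma rdot0r x : rdot x 0 = 0.
Proof. by rewrite rdotC rdot0l. Qed.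

Definition rdotE := (rdotDl, rdotDr, rdotNl, rdotNr, rdotZl, rdotZr).

Lemma normE x : `|x| = (nr x)%:C.
Proof. by rewrite /nr RRe_real // normr_real. Qed.

Lemma nr_ge0 x : 0 <= nr x.
Proof. by rewrite -ler0c -normE. Qed.

Lemma nrD x y : nr (x + y) <= nr x + nr y.
Proof. by rewrite -lecR rmorphD /= -!normE ler_normD. Qed.

Lemma nrN x : nr (- x) = nr x.
Proof. by rewrite /nr normrN. Qed.

Lemma nrZ a x : nr (a%:C *: x) = `|a| * nr x.
Proof.
apply: complexI; rewrite -normE normrZ normE rmorphM /=; congr (_ * _).
by rewrite normc_def /= expr0n /= addr0 sqrtr_sqr.
Qed.

Lemma nrZC (k : R[i]) x : nr (k *: x) = complex.Re `|k| * nr x.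
Proof.
apply: complexI; rewrite -normE normrZ normE rmorphM.
have h : (complex.Re `|k|)%:C = `|k| by rewrite RRe_real ?normr_real.
by rewrite -[X in X * _]h.
Qed.

Lemma nr0 : nr 0 = 0.
Proof. by rewrite /nr normr0. Qed.

Lemma nr_eq0 x : nr x = 0 -> x = 0.
Proof. by move=> h; apply: normr0_eq0; rewrite normE h. Qed.

Lemma nr_gt0 x : x != 0 -> 0 < nr x.
Proof.
move=> x0; rewrite lt_def nr_ge0 andbT; apply: contraNneq x0.
by move/nr_eq0 ->.
Qed.

Lemma rdotxx x : rdot x x = nr x ^+ 2.
Proof. by apply: complexI;
  rewrite rmorphXn /= -normE -hdot_norm /rdot RRe_real// hdot_norm realX//
  normr_real. Qed.

Lemma rdotxx_ge0 x : 0 <= rdot x x.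
Proof. by rewrite rdotxx sqr_ge0. Qed.

Lemma rdotxx_eq0 x : rdot x x = 0 -> x = 0.
Proof. by rewrite rdotxx => /eqP; rewrite sqrf_eq0 => /eqP /nr_eq0. Qed.

(** Testing against every vector turns an identity between vectors into a scalar identity that a
    ring computation settles. *)
Lemma rdot_inj x y : (forall z, rdot x z = rdot y z) -> x = y.
Proof.
move=> h; apply/eqP; rewrite -subr_eq0; apply/eqP/rdotxx_eq0.
by rewrite {1}rdotDl rdotNl h subrr.
Qed.

End RealStructure.

Lemma quadratic_ge0_disc (R : realType) (p q r : R) :
  (forall t, 0 <= p + 2 * t * r + t ^+ 2 * q) -> r ^+ 2 <= p * q.
Proof.
move=> h.
have q0 : 0 <= q.
  rewrite leNgt; apply/negP => q0.
  (* This [t] satisfies [t >= 1] and [t q = q - |p|], hence [t^2 q <= q - |p|]; the values at [t]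
     and [- t] then have a negative sum. *)
  set t := 1 + `|p| / - q.
  have t1 : 1 <= t by rewrite lerDl divr_ge0 // oppr_ge0 ltW.
  have tq : t * q = q - `|p|.
    by rewrite /t mulrDl mul1r invrN mulrN mulNr divfK // lt_eqF.
  have tt : t ^+ 2 * q <= t * q by rewrite ler_wnM2r ?(ltW q0) //
    expr2 ler_peMl // (le_trans ler01).
  by have := h t; have := h (- t); have := ler_norm p; rewrite sqrrN; lra.
have [q1|q1] := eqVneq q 0.
  rewrite q1 mulr0; have [->|r0] := eqVneq r 0; first by rewrite expr0n.
  (* With [q = 0] the expression is affine in [t], and here it takes the value [-1]. *)
  have := h (- (p + 1) / (2 * r)); rewrite q1 mulr0 addr0.
  have -> : 2 * (- (p + 1) / (2 * r)) * r = - (p + 1) by field.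
  lra.
have := h (- r / q).
have -> : p + 2 * (- r / q) * r + (- r / q) ^+ 2 * q = (p * q - r ^+ 2) / q.
  by field.
rewrite pmulr_lge0 ?subr_ge0 // invr_gt0 lt_def q1 //.
Qed.

(** * Bounded self-adjoint operators and their quadratic forms *)

Section Operators.
Context {R : realType} {H : hilbertType R}.
Implicit Types (x y z : H) (a b c : R) (S T A B P : H -> H).

(* Bounded self-adjoint operators: for a complex-linear [T], symmetry for the
   real part of the inner product is self-adjointness. *)
Definition sop T : Prop :=
  [/\ linear T, exists c, forall x, nr (T x) <= c * nr x &
      forall x y, rdot (T x) y = rdot x (T y)].

Definition psd T : Prop := forall x, 0 <= rdot (T x) x.

(** A real-valued form of the operator order; on self-adjoint operators it agrees with [op_le] by
    [pleP]. *)
Definition ple S T : Prop := forall x, rdot (S x) x <= rdot (T x) x.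

(** The form of [T] at [x + t y] is a nonnegative quadratic in [t], so its discriminant is not
    positive. *)
Lemma cauchy_schwarz_psd T x y : sop T -> psd T ->
  rdot (T x) y ^+ 2 <= rdot (T x) x * rdot (T y) y.
Proof.
move=> [lT _ sT] pT; apply: quadratic_ge0_disc => t.
have := pT (x + t%:C *: y).
have -> : T (x + t%:C *: y) = T x + t%:C *: T y by rewrite addrC lT addrC.
rewrite !rdotE (sT y x) (rdotC y (T x)).
by congr (_ <= _); ring.
Qed.

Lemma sopD T x y : sop T -> T (x + y) = T x + T y.
Proof. by case=> lT _ _; rewrite -[x]scale1r lT !scale1r. Qed.

Lemma sop0 T : sop T -> T 0 = 0.
Proof. by move=> h; apply: (addrI (T 0)); rewrite -sopD // !addr0. Qed.

Lemma sopZ T (c : R[i]) x : sop T -> T (c *: x) = c *: T x.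
Proof. by move=> h; case: (h) => lT _ _; rewrite -[c *: x]addr0 lT sop0 //
  addr0. Qed.

Lemma sopN T x : sop T -> T (- x) = - T x.
Proof. by move=> h; rewrite -scaleN1r sopZ // scaleN1r. Qed.

Lemma sopB T x y : sop T -> T (x - y) = T x - T y.
Proof. by move=> h; rewrite sopD // sopN. Qed.

Lemma sopS T x y : sop T -> rdot (T x) y = rdot x (T y).
Proof. by case. Qed.

Lemma sop_bound T : sop T ->
  exists2 c, 0 < c & forall x, nr (T x) <= c * nr x.
Proof.
case=> _ [c hc] _; exists (`|c| + 1) => [|x].
  by rewrite ltr_wpDl.
apply: le_trans (hc x) _; rewrite ler_wpM2r ?nr_ge0 //.
by rewrite (le_trans (ler_norm c)) // lerDl.
Qed.

Lemma sop_id : sop idfun.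
Proof. by split => //; exists 1 => x; rewrite mul1r. Qed.

Lemma sop_0 : sop 0.
Proof.
split; first by move=> a x y /=; rewrite /GRing.zero /= scaler0 addr0.
  by exists 0 => x; rewrite nr0 mul0r.
by move=> x y; rewrite rdot0l rdot0r.
Qed.

Lemma sop_scale a T : sop T -> sop (a%:C *: T).
Proof.
move=> h; case: (h) => lT [c hc] sT; split.
- move=> k x y; rewrite !fctE lT scalerDr !scalerA.
  by congr (_ *: _ + _); exact: mulrC.
- exists (`|a| * c) => x; rewrite fctE nrZ -mulrA ler_wpM2l //.
- by move=> x y; rewrite !fctE rdotZl rdotZr sT.
Qed.

Lemma sop_add S T : sop S -> sop T -> sop (S + T).
Proof.
move=> [lS [c hc] sS] [lT [d hd] sT]; split.
- by move=> k x y; rewrite !fctE lS lT scalerDr addrACA.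
- exists (c + d) => x; rewrite fctE (le_trans (nrD _ _)) // mulrDl lerD //.
- by move=> x y; rewrite !fctE rdotDl rdotDr sS sT.
Qed.

Lemma scaleN1C T : - T = ((-1)%:C : R[i]) *: T.
Proof. by rewrite rmorphN1 scaleN1r. Qed.

Lemma sop_opp T : sop T -> sop (- T).
Proof. by rewrite scaleN1C; exact: sop_scale. Qed.

Lemma sop_sub S T : sop S -> sop T -> sop (S - T).
Proof. by move=> hS hT; apply: sop_add hS (sop_opp hT). Qed.

Lemma sop_sum (n : nat) (T_ : 'I_n -> H -> H) :
  (forall j, sop (T_ j)) -> sop (\sum_(j < n) T_ j).
Proof.
by move=> h; elim/big_ind: _ => //; [exact: sop_0|exact: sop_add].
Qed.

Lemma nr_comp S T : sop S -> sop T ->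
  exists c, forall x, nr ((S \o T) x) <= c * nr x.
Proof.
move=> /sop_bound[c c0 hc] /sop_bound[d d0 hd]; exists (c * d) => x /=.
by rewrite (le_trans (hc _)) // -mulrA ler_pM2l.
Qed.

Lemma sop_comp S T : sop S -> sop T -> (forall x, S (T x) = T (S x)) ->
  sop (S \o T).
Proof.
move=> hS hT ST; split.
- by move=> k x y /=; rewrite !(sopD, sopZ).
- exact: nr_comp.
- by move=> x y /=; rewrite sopS // sopS // ST.
Qed.

Lemma sop_conj S T : sop S -> sop T -> sop (S \o T \o S).
Proof.
move=> hS hT; split.
- by move=> k x y /=; rewrite !(sopD, sopZ).
- have /sop_bound[c c0 hc] := hS; have /sop_bound[d d0 hd] := hT.
  exists (c * (d * c)) => x /=.
  by rewrite (le_trans (hc _)) // -!mulrA ler_pM2l // (le_trans (hd _)) //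
    ler_pM2l.
- by move=> x y /=; rewrite !sopS.
Qed.

Lemma psd_eq0 T x : sop T -> psd T -> rdot (T x) x = 0 -> T x = 0.
Proof.
move=> hT pT h; apply: rdotxx_eq0; apply/eqP.
have := cauchy_schwarz_psd x (T x) hT pT; rewrite h mul0r => h'.
by rewrite -sqrf_eq0 eq_le h' sqr_ge0.
Qed.

Lemma cauchy_schwarz x y : rdot x y <= nr x * nr y.
Proof.
apply: le_trans (ler_norm _) _.
rewrite -(ler_pXn2r (n := 2)) ?nnegrE ?mulr_ge0 ?nr_ge0 //.
rewrite real_normK ?num_real // exprMn -!rdotxx.
exact: (cauchy_schwarz_psd _ _ sop_id rdotxx_ge0).
Qed.

Lemma rdot_bound T c x : (forall y, nr (T y) <= c * nr y) ->
  rdot (T x) x <= c * rdot x x.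
Proof.
move=> h; apply: le_trans (cauchy_schwarz _ _) _.
by rewrite rdotxx expr2 mulrA ler_wpM2r ?nr_ge0.
Qed.

(** In operator terms, [T^2 <= c T] when [0 <= T <= c]: Cauchy-Schwarz for the form of [T] at [x]
    and [T x], then division by the squared norm of [T x]. A nearly vanishing form thus forces a
    nearly vanishing vector. *)
Lemma psd_nr_le T c x : sop T -> psd T ->
  (forall y, rdot (T y) y <= c * rdot y y) ->
  nr (T x) ^+ 2 <= c * rdot (T x) x.
Proof.
move=> hT pT hc; have := cauchy_schwarz_psd x (T x) hT pT.
have [e|e] := eqVneq (nr (T x)) 0.
  have e' := nr_eq0 e.
  by move=> _; rewrite e' rdot0l mulr0 nr0 expr0n.
rewrite rdotxx => h.
have n0 : 0 < nr (T x) by rewrite lt_def e nr_ge0.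
rewrite -(ler_pM2r (exprn_gt0 2 n0)) -expr2 (le_trans h) // [leRHS]mulrAC mulrC.
by rewrite ler_wpM2r ?pT // -rdotxx.
Qed.
End Operators.

(** * Strong limits, square roots and spectral projections *)

Section Limits.
Context {R : realType} {H : hilbertType R}.
Implicit Types (x y z : H) (a b c : R) (S T A B P : H -> H).

Definition lim_to (u : nat -> H) (l : H) : Prop :=
  forall e : R, 0 < e -> exists N, forall n, (N <= n)%N -> nr (u n - l) < e.

Lemma lim_to_uniq u l l' : lim_to u l -> lim_to u l' -> l = l'.
Proof.
move=> h h'; apply/eqP; rewrite -subr_eq0; apply/eqP/nr_eq0/eqP.
rewrite eq_le nr_ge0 andbT; apply/ler_addgt0Pr => e e0; rewrite add0r.
have e2 : 0 < e / 2 by rewrite divr_gt0.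
have [N hN] := h _ e2; have [N' hN'] := h' _ e2.
have := hN _ (leq_maxl N N'); have := hN' _ (leq_maxr N N').
set n := maxn N N' => h1 h2.
have -> : l - l' = (u n - l') - (u n - l) by rewrite opprB [RHS]addrC addrA
  subrK.
by rewrite (le_trans (nrD _ _)) // nrN (splitr e) ltW // ltrD.
Qed.

Lemma lim_to_cst x : lim_to (fun=> x) x.
Proof. by move=> e e0; exists 0%N => n _; rewrite subrr nr0. Qed.

Lemma lim_to_ext u v l : u =1 v -> lim_to u l -> lim_to v l.
Proof. by move=> /funext ->. Qed.

Lemma lim_to_add u v l l' : lim_to u l -> lim_to v l' ->
  lim_to (fun n => u n + v n) (l + l').
Proof.
move=> h h' e e0.
have e2 : 0 < e / 2 by rewrite divr_gt0.
have [N hN] := h _ e2; have [N' hN'] := h' _ e2.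
exists (maxn N N') => n; rewrite geq_max => /andP[n1 n2].
rewrite opprD addrACA (le_lt_trans (nrD _ _)) // (splitr e) ltrD //.
  exact: hN.
exact: hN'.
Qed.

Lemma lim_to_bounded T c u l : (forall x y, T (x - y) = T x - T y) ->
  (forall x, nr (T x) <= c * nr x) ->
  lim_to u l -> lim_to (fun n => T (u n)) (T l).
Proof.
move=> TB hc h e e0.
have c0 : 0 < `|c| + 1 by rewrite ltr_wpDl.
have [N hN] := h (e / (`|c| + 1)) (divr_gt0 e0 c0).
exists N => n /hN; rewrite ltr_pdivlMr // mulrC => /(le_lt_trans _); apply.
rewrite -TB (le_trans (hc _)) // ler_wpM2r ?nr_ge0 //.
by rewrite (le_trans (ler_norm _)) // lerDl.
Qed.

Lemma lim_to_sop T u l : sop T -> lim_to u l -> lim_to (fun n => T (u n)) (T l).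
Proof.
move=> hT; have [c _ hc] := sop_bound hT.
by apply: lim_to_bounded hc => x y; rewrite sopB.
Qed.

Lemma lim_to_scale (k : R[i]) u l : lim_to u l ->
  lim_to (fun n => k *: u n) (k *: l).
Proof.
apply: (lim_to_bounded (c := complex.Re `|k|)) => x *;
  first by rewrite scalerBr.
by rewrite nrZC.
Qed.

Lemma lim_to_shift u l : lim_to u l -> lim_to (fun n => u n.+1) l.
Proof. by move=> h e /h[N hN]; exists N => n /leqW; exact: hN. Qed.

Lemma lim_to_rdot_le u l y c : lim_to u l -> (forall n, rdot (u n) y <= c) ->
  rdot l y <= c.
Proof.
move=> h hc; apply/ler_addgt0Pr => e e0.
have y0 : 0 < nr y + 1 by rewrite ltr_wpDl ?nr_ge0.
have [N /(_ N (leqnn N)) hN] := h (e / (nr y + 1)) (divr_gt0 e0 y0).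
have -> : l = u N - (u N - l) by rewrite opprB addrC subrK.
rewrite rdotDl rdotNl -rdotNl opprB lerD //.
apply: le_trans (cauchy_schwarz _ _) _.
rewrite -nrN opprB; move: hN; rewrite ltr_pdivlMr // => /ltW; apply: le_trans.
by rewrite ler_wpM2l ?nr_ge0 // lerDl.
Qed.

Lemma lim_to_rdot_eq u l u' l' y y' : lim_to u l -> lim_to u' l' ->
  (forall n, rdot (u n) y = rdot (u' n) y') -> rdot l y = rdot l' y'.
Proof.
have wlog : forall u l u' l' y y', lim_to u l -> lim_to u' l' ->
  (forall n, rdot (u n) y = rdot (u' n) y') -> rdot l y <= rdot l' y'.
  move=> {}u {}l {}u' {}l' {}y {}y' h h' e; apply/ler_addgt0Pr => d d0.
  have y0 : 0 < nr y' + 1 by rewrite ltr_wpDl ?nr_ge0.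
  have [N hN] := h' (d / (nr y' + 1)) (divr_gt0 d0 y0).
  have hs : lim_to (fun n => u (n + N)%N) l.
    move=> r /h[N' hN']; exists N' => n Nn; apply: hN'.
    by rewrite (leq_trans Nn) ?leq_addr.
  apply: (lim_to_rdot_le hs) => n; rewrite e.
  have -> : u' (n + N)%N = l' + (u' (n + N)%N - l') by rewrite addrC subrK.
  rewrite rdotDl lerD2l; apply: le_trans (cauchy_schwarz _ _) _.
  have := hN _ (leq_addl n N); rewrite ltr_pdivlMr // => /ltW; apply: le_trans.
  by rewrite ler_wpM2l ?nr_ge0 // lerDl.
move=> h h' e; apply/eqP; rewrite eq_le (wlog _ _ _ _ _ _ h h' e) /=.
by apply: (wlog _ _ _ _ _ _ h' h) => n; rewrite e.
Qed.

Lemma lim_to_nr_le u l c : lim_to u l -> (forall n, nr (u n) <= c) -> nr l <= c.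
Proof.
move=> h hc; apply/ler_addgt0Pr => e e0.
have [N /(_ N (leqnn N)) hN] := h e e0.
have -> : l = u N - (u N - l) by rewrite opprB addrC subrK.
by rewrite (le_trans (nrD _ _)) // nrN lerD // ltW.
Qed.

Lemma cauchy_lim_to (u : nat -> H) :
  (forall e : R, 0 < e -> exists N, forall n k, (N <= n)%N -> (n <= k)%N ->
     nr (u k - u n) <= e) -> exists l, lim_to u l.
Proof.
move=> hu.
have cu : cvg (u @ \oo)%classic.
  apply/cauchy_cvgP/cauchy_ballP => e e0; near_simpl.
  have er : e = (complex.Re e)%:C by rewrite RRe_real // gtr0_real.
  have e1 : 0 < complex.Re e by rewrite -ltcR -er.
  have [N hN] := hu (complex.Re e / 3) ltac:(by rewrite divr_gt0).
  exists ([set n | (N <= n)%N], [set n | (N <= n)%N])%classic.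
    by split; exists N.
  move=> [i j] /= [Ni Nj]; rewrite -ball_normE /= normE er ltcR.
  have -> : u i - u j = (u i - u N) - (u j - u N).
    by rewrite opprB addrA subrK.
  rewrite (le_lt_trans (nrD _ _)) // nrN.
  have := hN _ _ (leqnn N) Ni; have := hN _ _ (leqnn N) Nj; lra.
exists (lim (u @ \oo)%classic) => e e0.
have /cvgrPdist_lt /(_ e%:C) := cu.
rewrite ltcR => /(_ e0)[N _ hN]; exists N => n /hN.
by rewrite normE ltcR -nrN opprB.
Qed.

(* Cauchy-Schwarz for the positive form of [T_ k - T_ n] turns convergence of
   the quadratic forms into strong convergence. *)
Lemma monotone_strong_limit (T_ : nat -> H -> H) c :
  (forall n, sop (T_ n)) -> (forall n x, nr (T_ n x) <= c * nr x) ->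
  (forall n, ple (T_ n) (T_ n.+1)) ->
  exists T, [/\ sop T, forall x, nr (T x) <= c * nr x,
                forall n, ple (T_ n) T & forall x, lim_to (T_ ^~ x) (T x)].
Proof.
move=> hT hc hm.
have mono x n k : (n <= k)%N -> rdot (T_ n x) x <= rdot (T_ k x) x.
  move=> /subnK <-; elim: (k - n)%N => [|j IH]; first by rewrite add0n.
  by rewrite addSn (le_trans IH) // hm.
have lim x : exists l, lim_to (T_ ^~ x) l.
  apply: cauchy_lim_to => e e0.
  have c0 : 0 <= `|c| by [].
  pose q := [set rdot (T_ n x) x | n in [set: nat]]%classic.
  have hq : has_sup q.
    split; first by exists (rdot (T_ 0%N x) x), 0%N.
    exists (c * rdot x x) => _ [n _ <-].
    exact: rdot_bound.
  (* [T_ k - T_ n] has form at most [2 (|c| + 1)], so by [psd_nr_le] this tolerance on the form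
     gives [e] on the norm. *)
  have d0 : 0 < e ^+ 2 / (2 * (`|c| + 1)) by rewrite divr_gt0 ?exprn_gt0 //
    mulr_gt0 // ltr_wpDl.
  have [_ [N _ <-] hN] := sup_adherent d0 hq.
  exists N => n k Nn nk.
  rewrite -(ler_pXn2r (n := 2)) ?nnegrE ?nr_ge0 ?(ltW e0) //.
  have hW : sop (T_ k - T_ n) by apply: sop_sub.
  have pW : psd (T_ k - T_ n).
    by move=> y; rewrite !fctE rdotDl rdotNl subr_ge0 mono.
  have bW y : rdot ((T_ k - T_ n) y) y <= (2 * (`|c| + 1)) * rdot y y.
    apply: rdot_bound => z; rewrite !fctE (le_trans (nrD _ _)) // nrN.
    have := hc k z; have := hc n z; have := ler_norm c; have := nr_ge0 z; nra.
  have := psd_nr_le x hW pW bW; rewrite !fctE => h; apply: le_trans h _.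
  rewrite rdotDl rdotNl mulrC -ler_pdivlMr ?mulr_gt0 ?ltr_wpDl //.
  have := sup_upper_bound hq (ex_intro2 _ _ k I erefl).
  have := mono x _ _ Nn; move: hN; lra.
pose T x := projT1 (cid (lim x)).
have Tl x : lim_to (T_ ^~ x) (T x) by rewrite /T; case: cid.
exists T; split => //.
- split.
  + move=> k x y; apply: (lim_to_uniq (Tl _)).
    apply: lim_to_ext (lim_to_add (lim_to_scale k (Tl x)) (Tl y)) => n.
    by rewrite sopD ?sopZ.
  + by exists c => x; apply: lim_to_nr_le (Tl x) _ => n; exact: hc.
  + move=> x y; rewrite [RHS]rdotC; apply: lim_to_rdot_eq (Tl x) (Tl y) _ => n.
    by rewrite sopS // rdotC.
- by move=> x; apply: lim_to_nr_le (Tl x) _ => n; exact: hc.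
- move=> n x; rewrite -lerN2 -!rdotNr.
  have Tl' : lim_to (fun k => T_ (k + n)%N x) (T x).
    by move=> e /(Tl x)[N hN]; exists N => k Nk; apply: hN;
      rewrite (leq_trans Nk) ?leq_addr.
  by apply: lim_to_rdot_le Tl' _ => k; rewrite !rdotNr lerN2 mono ?leq_addl.
Unshelve. all: by end_near. Qed.

End Limits.

(** * Approximate eigenvectors and Loewner's inequality for squares *)

Section OrderOfOperators.
Context {R : realType} {H : hilbertType R}.
Implicit Types (x y z : H) (a b c : R) (S T A B P D X : H -> H).

Lemma sop_shift T c : sop T -> sop (T - c%:C *: idfun).
Proof. by move=> hT; apply: sop_sub => //; apply: sop_scale; exact: sop_id. Qed.

(** Let [l] be the infimum of the form of [D] on the unit sphere. Then [D - l] is positive, and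
    [psd_nr_le] makes it small in norm at unit vectors where its form is small. *)
Lemma approximate_eigenvector D : sop D -> ~ psd D ->
  exists2 l : R, l < 0 & forall e : R, 0 < e ->
    exists2 x, rdot x x = 1 & nr (D x - l%:C *: x) <= e.
Proof.
move=> hD; move/existsNP => [x0 /negP]; rewrite -ltNge => Dx0.
have x00 : x0 != 0 by apply: contraTneq Dx0 => ->; rewrite rdot0r ltxx.
pose q := [set rdot (D x) x | x in [set x | rdot x x = 1]]%classic.
have [C C0 hC] := sop_bound hD.
have n0 := nr_gt0 x00.
have x1 : rdot ((nr x0)^-1%:C *: x0) ((nr x0)^-1%:C *: x0) = 1.
  by rewrite rdotZl rdotZr rdotxx; field; rewrite gt_eqF.
have hq : has_inf q.
  split; first by exists (rdot (D ((nr x0)^-1%:C *: x0)) ((nr x0)^-1%:C *: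
    x0)), ((nr x0)^-1%:C *: x0).
  exists (- C) => _ [x /= xx <-].
  rewrite lerNl -rdotNl -[C]mulr1 -xx.
  by apply: (@rdot_bound _ _ (- D)) => y; rewrite fctE nrN.
set l := inf q.
have lD x : l * rdot x x <= rdot (D x) x.
  have [->|xn0] := eqVneq x 0; first by rewrite !rdot0r mulr0.
  have nx := nr_gt0 xn0.
  have : l <= rdot (D ((nr x)^-1%:C *: x)) ((nr x)^-1%:C *: x).
    apply: (ge_inf hq.2); exists ((nr x)^-1%:C *: x) => //=.
    by rewrite rdotZl rdotZr rdotxx; field; rewrite gt_eqF.
  rewrite sopZ // rdotZl rdotZr rdotxx mulrA -invfM -expr2 mulrC.
  by rewrite ler_pdivlMr ?exprn_gt0.
have l0 : l < 0.
  by have := le_lt_trans (lD x0) Dx0; rewrite pmulr_llt0 // rdotxx exprn_gt0.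
exists l => // e e0.
have hS := sop_shift l hD.
have [c c0 hc] := sop_bound hS.
have pS : psd (D - l%:C *: idfun).
  by move=> x; rewrite !fctE rdotDl rdotNl rdotZl subr_ge0.
have d0 : 0 < e ^+ 2 / c by rewrite divr_gt0 ?exprn_gt0.
have [_ [x /= xx <-] hx] := inf_adherent d0 hq.
exists x => //.
have := psd_nr_le x hS pS (fun y => rdot_bound y hc).
rewrite !fctE => h; rewrite -(ler_pXn2r (n := 2)) ?nnegrE ?nr_ge0 ?(ltW e0) //.
apply: le_trans h _; rewrite mulrC -ler_pdivlMr //
  rdotDl rdotNl rdotZl xx mulr1.
by rewrite lerBlDl ltW.
Qed.

(* If [T - X] had an approximate eigenvector [x] with eigenvalue [l < 0], then
   [X x] would be close to [T x - l x], which is longer than [T x]. *)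
Lemma loewner T X : sop T -> psd T -> sop X ->
  (forall x, rdot (X x) (X x) <= rdot (T x) (T x)) -> ple X T.
Proof.
move=> hT pT hX h; suff : psd (T - X).
  by move=> p x; have := p x; rewrite fctE rdotDl rdotNl subr_ge0.
apply: contrapT => /(approximate_eigenvector (sop_sub hT hX))[l l0 hl].
have [c c0 hc] := sop_bound hT.
(* Expanding the square of [T x - l x - r], the terms linear in [r] amount to at most
   [2 (c - l) eta = l^2 / 2], too little to offset [l^2]. *)
pose eta := l ^+ 2 / (4 * (c - l)).
have cl : 0 < c - l by rewrite subr_gt0 (lt_trans l0).
have l2 : 0 < l ^+ 2 by rewrite exprn_even_gt0 //= lt_eqF.
have eta0 : 0 < eta by rewrite divr_gt0 // mulr_gt0.
have [x xx] := hl _ eta0; rewrite fctE; set r := _ - l%:C *: x => hr.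
have nx : nr x = 1 by apply/eqP; rewrite -sqrp_eq1 ?nr_ge0 // -rdotxx xx.
have eX : X x = T x - l%:C *: x - r.
  by rewrite /r [T x - X x - _]addrAC subKr.
clearbody r; have := h x;
  rewrite eX !rdotE (rdotC (T x) x) (rdotC r (T x)) (rdotC r x) xx => k.
have k1 := pT x; have k2 := rdotxx_ge0 r.
have k3 : rdot (T x) r <= c * nr r.
  apply: le_trans (cauchy_schwarz _ _) _.
  by rewrite ler_wpM2r ?nr_ge0 // -[c]mulr1 -nx.
have k4 : - l * rdot x r <= - l * nr r.
  rewrite ler_wpM2l ?oppr_ge0 ?(ltW l0) //.
  by apply: le_trans (cauchy_schwarz _ _) _; rewrite nx mul1r.
have k5 : (c - l) * nr r <= (c - l) * eta by rewrite ler_pM2l.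
have k6 : (c - l) * eta = l ^+ 2 / 4 by rewrite /eta; field; rewrite gt_eqF.
rewrite (rdotC (T x) x) in k1.
have k7 : 0 <= l * - rdot x (T x) by rewrite mulrN -mulNr mulr_ge0 ?oppr_ge0
  ?(ltW l0) // rdotC pT.
have : l ^+ 2 <= l ^+ 2 / 2.
  rewrite (_ : l ^+ 2 / 2 = 2 * (l ^+ 2 / 4)); last by field.
  rewrite -k6; move: k k2 k3 k4 k5 k7; rewrite ?expr2; lra.
by rewrite leNgt ltr_pdivrMr ?ltr_pMr // ltr1n.
Qed.

Lemma ple_antisym S T : sop S -> sop T -> ple S T -> ple T S -> S = T.
Proof.
move=> hS hT h1 h2; apply/funext => x.
have hD := sop_sub hS hT.
have z y : rdot ((S - T) y) y = 0.
  rewrite fctE rdotDl rdotNl; apply/eqP; rewrite subr_eq0.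
  by rewrite eq_le h1 h2.
have : (S - T) x = 0 by apply: psd_eq0 => // y; rewrite z.
by rewrite fctE => /eqP; rewrite subr_eq0 => /eqP.
Qed.

(** Equal squares make [S x] and [T x] equally long, so [loewner] applies in both directions. *)
Lemma sqrt_unique S T : sop S -> psd S -> sop T -> psd T ->
  (forall x, S (S x) = T (T x)) -> S = T.
Proof.
move=> hS pS hT pT e.
by apply: ple_antisym => //; apply: loewner => // x; rewrite !sopS // e.
Qed.

End OrderOfOperators.

(** * Operator polynomials with nonnegative coefficients *)

Definition commutes (U : Type) (S T : U -> U) : Prop := forall x, S (T x) = T
  (S x).

Section NonnegativePolynomials.
Context {R : realType} {H : hilbertType R}.
Variable K : H -> H.
Hypothesis hK : sop K.
Implicit Types (x y z : H) (S T C : H -> H).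

(** Polynomials in [K] with nonnegative coefficients. They are positive when [K] is, so an iteration
    whose increments are of this kind is increasing. *)
Inductive npoly : (H -> H) -> Prop :=
| npoly_id : npoly idfun
| npoly_mul T : npoly T -> npoly (K \o T)
| npoly_add S T : npoly S -> npoly T -> npoly (S + T)
| npoly_scale (a : R) T : 0 <= a -> npoly T -> npoly (a%:C *: T).

Lemma npoly_0 : npoly 0.
Proof. by rewrite -(scale0r idfun); apply: (@npoly_scale 0) => //;
  exact: npoly_id. Qed.

Lemma npoly_self : npoly K.
Proof. exact: npoly_mul npoly_id. Qed.

(** Self-adjointness of [K \o T] rests on [T] commuting with [K], so one induction carries both
    facts. *)
Lemma npoly_sop_comm T : npoly T ->
  sop T /\ forall C, sop C -> commutes C K -> commutes C T.
Proof.
elim=> [|{}T _ [hT cT]|S {}T _ [hS cS] _ [hT cT]|a {}T _ _ [hT cT]].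
- by split=> //; exact: sop_id.
- split; first by apply: sop_comp => //; apply: cT.
  by move=> C hC cC x /=; rewrite cC cT.
- split; first exact: sop_add.
  by move=> C hC cC x; rewrite !fctE sopD // cS // cT.
- split; first exact: sop_scale.
  by move=> C hC cC x; rewrite !fctE sopZ // cT.
Qed.

Lemma npoly_sop T : npoly T -> sop T.
Proof. by case/npoly_sop_comm. Qed.

Lemma npoly_comp S T : npoly S -> npoly T -> npoly (S \o T).
Proof.
move=> hS hT; elim: hS => // [S' _ IH|S' S'' _ h' _ h''|a S' a0 _ h].
- exact: (npoly_mul IH).
- exact: (npoly_add h' h'').
- exact: (npoly_scale a0 h).
Qed.

(** Two consecutive powers go together, because the form of [K^(n+2)] at [x] is that of [K^n] at
    [K x]. *)
Lemma psd_iter n : psd K -> psd (iter n K).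
Proof.
move=> pK; suff : psd (iter n K) /\ psd (iter n.+1 K) by case.
elim: n => [|n [IH IH']]; first by split => // x; exact: rdotxx_ge0.
by split=> // x; rewrite iterS iterSr sopS //; exact: IH.
Qed.

Lemma npoly_psd T : psd K -> npoly T -> psd T.
Proof.
(* Multiplication by [K] does not preserve positivity by itself; carrying an arbitrary power of [K]
   in front makes the induction pass. *)
move=> pK hT; suff h n : psd (iter n K \o T) by exact: (h 0%N).
elim: hT n => [|{}T _ IH|S {}T hS IS hT IT|a {}T a0 hT IT] n x.
- exact: psd_iter.
- by have := IH n.+1 x; rewrite /= -iterS iterSr.
- have e : iter n K ((S + T) x) = iter n K (S x) + iter n K (T x).
    by rewrite fctE; elim: {IS IT} n => //= n ->; rewrite sopD.
  by rewrite /= e rdotDl addr_ge0 //; [exact: IS|exact: IT].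
- have e : iter n K ((a%:C *: T) x) = a%:C *: iter n K (T x).
    by rewrite fctE; elim: {IT} n => //= n ->; rewrite sopZ.
  by rewrite /= e rdotZl mulr_ge0 //; exact: IT.
Qed.

End NonnegativePolynomials.

(** * Inverses and square roots as limits of increasing iterations *)

Section MonotoneIterations.
Context {R : realType} {H : hilbertType R}.
Implicit Types (x y z : H) (a b c : R) (S T A B C E K P : H -> H).

Lemma commutes_lim (T_ : nat -> H -> H) T C : sop C ->
  (forall x, lim_to (T_ ^~ x) (T x)) -> (forall n, commutes C (T_ n)) ->
  commutes C T.
Proof.
move=> hC hT cT x; apply: (lim_to_uniq (lim_to_sop hC (hT x))).
by apply: lim_to_ext (hT (C x)) => n; rewrite cT.
Qed.

Lemma psd_contraction K c : sop K -> psd K -> 0 <= c ->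
  (forall x, rdot (K x) x <= c * rdot x x) -> forall x, nr (K x) <= c * nr x.
Proof.
move=> hK pK c0 h x.
rewrite -(ler_pXn2r (n := 2)) ?nnegrE ?mulr_ge0 ?nr_ge0 //.
apply: le_trans (psd_nr_le x hK pK h) _.
by rewrite exprMn expr2 -mulrA ler_wpM2l // -rdotxx.
Qed.

(** Neumann series. For an upper bound [C] of [A], the operator [K = 1 - A / C] lies between [0] and
    [q < 1]. The partial sums [Y] increase to some [L] with [L = 1 + K L], that is [A L = C]. *)
Lemma inverse_exists A c : sop A -> 0 < c ->
  (forall x, c * rdot x x <= rdot (A x) x) ->
  exists B, [/\ sop B, forall x, A (B x) = x, forall x, B (A x) = x & psd B].
Proof.
move=> hA c0 hc; have [C' C'0 hC'] := sop_bound hA.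
pose C := C' + c; have C0 : 0 < C by rewrite addr_gt0.
have hC x : rdot (A x) x <= C * rdot x x.
  by rewrite (le_trans (rdot_bound x hC')) // ler_wpM2r ?rdotxx_ge0 //
    lerDl ltW.
pose K : H -> H := idfun - C^-1%:C *: A.
have hK : sop K by apply: sop_sub; [exact: sop_id|exact: sop_scale].
have KE x : K x = x - C^-1%:C *: A x by rewrite /K !fctE.
have pK : psd K.
  by move=> x; rewrite KE rdotDl rdotNl rdotZl subr_ge0 mulrC ler_pdivrMr //
    mulrC.
pose q := 1 - c / C.
have q0 : 0 <= q by rewrite subr_ge0 ler_pdivrMr // mul1r lerDr ltW.
have Kq x : nr (K x) <= q * nr x.
  apply: psd_contraction => // y.
  rewrite KE rdotDl rdotNl rdotZl /q mulrBl mul1r lerD2l lerN2.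
  by rewrite mulrAC mulrC ler_wpM2l // invr_ge0 ltW.
(* [N = 1 / (1 - q)] is the sum of the geometric series, hence a bound for all partial sums. *)
pose N := C / c; have N0 : 0 <= N by rewrite divr_ge0 ?ltW.
have qN : 1 + q * N = N by rewrite /q /N; field; rewrite !gt_eqF.
pose fix Y n : H -> H := if n is n'.+1 then idfun + (K \o Y n') else 0.
have YE n x : Y n.+1 x = x + K (Y n x) by [].
have nY n : npoly K (Y n).
  elim: n => [|n IH] /=; first exact: npoly_0.
  by apply: npoly_add; [exact: npoly_id|exact: npoly_mul].
have sY n : sop (Y n) by exact: npoly_sop (nY n).
have bY n x : nr (Y n x) <= N * nr x.
  elim: n => [|n IH]; first by rewrite nr0 mulr_ge0 ?nr_ge0.
  rewrite YE (le_trans (nrD _ _)) // -qN mulrDl mul1r lerD2l.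
  by rewrite (le_trans (Kq _)) // -mulrA ler_wpM2l.
have mY n : ple (Y n) (Y n.+1).
  have [D [nD eD]] : exists D, npoly K D /\ forall x, Y n.+1 x = Y n x + D x.
    elim: n => [|n [D [nD eD]]].
      exists idfun; split; first exact: npoly_id.
      by move=> x; rewrite YE sop0 // addr0 add0r.
    exists (K \o D); split; first exact: npoly_mul.
    by move=> x; rewrite (YE n.+1) (YE n x) -addrA -sopD // -eD.
  by move=> x; rewrite eD rdotDl lerDl; exact: (npoly_psd hK pK nD).
have [L [hL _ _ lL]] := monotone_strong_limit sY bY mY.
have eL x : L x = x + K (L x).
  apply: (lim_to_uniq (lim_to_shift (lL x))).
  apply: lim_to_ext (lim_to_add (lim_to_cst x) (lim_to_sop hK (lL x))) => n.
  by rewrite YE.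
have AL x : A (L x) = C%:C *: x.
  have := eL x; rewrite KE addrCA -[LHS]addr0 => /addrI/eqP.
  rewrite eq_sym subr_eq0 => /eqP {2}->.
  by rewrite scalerA -rmorphM mulfV ?gt_eqF // scale1r.
have cL : commutes A L.
  apply: (commutes_lim hA lL) => n; have [_ h] := npoly_sop_comm hK (nY n).
  by apply: h => // x; rewrite !KE sopB // sopZ.
have AB x : A (C^-1%:C *: L x) = x.
  by rewrite sopZ // AL scalerA -rmorphM mulVf ?gt_eqF // scale1r.
have BA x : C^-1%:C *: L (A x) = x by rewrite -cL -sopZ.
exists (C^-1%:C *: L); split => //; first exact: sop_scale.
move=> x; rewrite fctE; set y := _ *: L x.
by rewrite -[x]AB -/y rdotC (le_trans _ (hc y)) // mulr_ge0 ?rdotxx_ge0 ?ltW.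
Qed.

(* [S = 1 - Y] where [Y] is the increasing limit of [Y' = (K + Y^2) / 2], with
   [K = 1 - A]. *)
Lemma sqrt_exists A : sop A -> psd A ->
  exists S, [/\ sop S, psd S, forall x, S (S x) = A x &
    forall C, sop C -> commutes C A -> commutes C S].
Proof.
move=> hA pA; have [c c0 hc] := sop_bound hA.
(* Dividing by the bound [c] puts [A] below the identity, so that [0 <= K <= 1]; the factor
   [Num.sqrt c] in [S] undoes this. *)
pose K : H -> H := idfun - c^-1%:C *: A.
have hK : sop K by apply: sop_sub; [exact: sop_id|exact: sop_scale].
have KE x : K x = x - c^-1%:C *: A x by rewrite /K !fctE.
clearbody K; have pK : psd K.
  move=> x; rewrite KE rdotDl rdotNl rdotZl subr_ge0 mulrC ler_pdivrMr // mulrC.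
  exact: rdot_bound.
have K1 x : nr (K x) <= nr x.
  rewrite -[leRHS]mul1r; apply: psd_contraction => // y.
  rewrite KE rdotDl rdotNl rdotZl mul1r gerBl mulr_ge0 ?invr_ge0 ?(ltW c0) //.
pose fix Y n : H -> H :=
  if n is n'.+1 then 2^-1%:C *: (K + (Y n' \o Y n')) else 0.
have YE n x : Y n.+1 x = 2^-1%:C *: (K x + Y n (Y n x)) by rewrite /= !fctE.
have h2 : 0 <= 2^-1 :> R by rewrite invr_ge0.
have nY n : npoly K (Y n).
  elim: n => [|n IH] /=; first exact: npoly_0.
  apply: npoly_scale => //; apply: npoly_add; first exact: npoly_self.
  exact: npoly_comp.
have sY n : sop (Y n) by exact: npoly_sop (nY n).
have bY n x : nr (Y n x) <= 1 * nr x.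
  rewrite mul1r; elim: n x => [|n IH] x; first by rewrite nr0 nr_ge0.
  rewrite YE nrZ ger0_norm // mulrC ler_pdivrMr // mulrDr mulr1.
  by rewrite (le_trans (nrD _ _)) // lerD // (le_trans (IH _)).
have mY n : ple (Y n) (Y n.+1).
  (* If [Y n.+1 = Y n + D], the next increment is [(Y n.+1 D + D Y n) / 2], again a polynomial with
     nonnegative coefficients. *)
  have [D [nD eD]] : exists D, npoly K D /\ forall x, Y n.+1 x = Y n x + D x.
    elim: n => [|n [D [nD eD]]].
      exists (Y 1%N); split => // x.
      by rewrite [Y 0%N x](_ : _ = 0) ?add0r.
    exists (2^-1%:C *: (Y n.+1 \o D + (D \o Y n))); split.
      by apply: npoly_scale => //; apply: npoly_add; apply: npoly_comp.
    move=> x; rewrite [LHS]YE [Y n.+1 x in RHS]YE.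
    have -> : (2^-1%:C *: (Y n.+1 \o D + (D \o Y n))) x
      = 2^-1%:C *: (Y n.+1 (D x) + D (Y n x)) by [].
    rewrite -scalerDr -addrA; congr (_ *: (_ + _)).
    by rewrite [Y n.+1 x]eD sopD // (eD (Y n x)) -addrA [D _ + _]addrC.
  by move=> x; rewrite eD rdotDl lerDl; exact: (npoly_psd hK pK nD).
have [L [hL L1 _ lL]] := monotone_strong_limit sY bY mY.
(* Squares converge strongly because the [Y n] are contractions: [Y n (Y n x - L x)] tends to
   [0]. *)
have lLL x : lim_to (fun n => Y n (Y n x)) (L (L x)).
  have e n : Y n (Y n x) = Y n (L x) + Y n (Y n x - L x).
    by rewrite sopB // addrC subrK.
  apply: lim_to_ext (fun n => esym (e n)) _.
  rewrite -[L (L x)]addr0; apply: lim_to_add (lL _) _ => d /(lL x)[N hN].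
  by exists N => n /hN; rewrite subr0; apply: le_lt_trans;
    rewrite -[leRHS]mul1r.
have eL x : L x = 2^-1%:C *: (K x + L (L x)).
  apply: (lim_to_uniq (lim_to_shift (lL x))).
  apply: lim_to_ext (fun n => esym (YE n x)) _.
  by apply: lim_to_scale; apply: lim_to_add (lLL x); exact: lim_to_cst.
(* Hence [(1 - L)^2 = 1 - K = A / c]. *)
have eL2 x : L (L x) = 2%:C *: L x - K x.
  rewrite [X in _ *: X - _]eL scalerA -rmorphM mulfV // scale1r addrC addrA.
  by rewrite addNr add0r.
pose S : H -> H := (Num.sqrt c)%:C *: (idfun - L).
have SE x : S x = (Num.sqrt c)%:C *: (x - L x) by rewrite /S !fctE.
have hS : sop S by apply: sop_scale; apply: sop_sub hL; exact: sop_id.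
exists S; split => //.
- move=> x; rewrite SE rdotZl mulr_ge0 ?sqrtr_ge0 // rdotDl rdotNl subr_ge0.
  by rewrite -[leRHS]mul1r; exact: rdot_bound.
- move=> x; rewrite !SE (sopZ _ _ hL) (sopB _ _ hL) -scalerBr scalerA -rmorphM
    -expr2.
  rewrite sqr_sqrtr ?ltW // eL2 KE.
  have -> : x - L x - (L x - (2%:C *: L x - (x - c^-1%:C *: A x))) = c^-1%:C *:
    A x.
    by apply: rdot_inj => z; rewrite !rdotE; ring.
  by rewrite scalerA -rmorphM mulfV ?gt_eqF // scale1r.
- move=> C hC cC x; rewrite !SE (sopZ _ _ hC) (sopB _ _ hC).
  congr (_ *: (_ - _)); apply: (commutes_lim hC lL) => n.
  have [_ h] := npoly_sop_comm hK (nY n); apply: h => // y.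
  by rewrite !KE (sopB _ _ hC) (sopZ _ _ hC) cC.
Qed.
End MonotoneIterations.

(** * Spectral projections from positive and negative parts *)

Section SpectralProjection.
Context {R : realType} {H : hilbertType R}.
Implicit Types (x y z : H) (a b c t : R) (S T A B C D E K P U V : H -> H).

Lemma sop_iter K n : sop K -> sop (iter n K).
Proof.
move=> hK; elim: n => [|n IH]; first exact: sop_id.
by apply: (sop_comp hK IH) => x; rewrite -iterS -iterSr.
Qed.

(* With [U] the positive part of [E - t], the projection onto [ker U] is the
   decreasing limit of [(1 - U / c)^(2n)]. *)
Lemma spectral_projection E t : sop E -> exists P,
  [/\ sop P, forall x, P (P x) = P x,
      forall C, sop C -> commutes C E -> commutes C P,
      forall x, rdot (E (P x)) (P x) <= t * rdot (P x) (P x) &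
      forall x, P x = 0 -> t * rdot x x <= rdot (E x) x].
Proof.
move=> hE; pose D : H -> H := E - t%:C *: idfun.
have DE x : D x = E x - t%:C *: x by rewrite /D !fctE.
have hD : sop D by exact: sop_shift.
clearbody D.
have hDD : sop (D \o D) by exact: sop_comp.
have pDD : psd (D \o D) by move=> x; rewrite /= sopS // rdotxx_ge0.
have [S [hS pS SS cS]] := sqrt_exists hDD pDD.
have DS : commutes D S by exact: cS.
(* [S] is the absolute value of [D], so [U] and [V] are the positive and negative parts. Their
   positivity is [loewner] for [- D <= S] and [D <= S], as [S] and [D] have equal squares. *)
pose U : H -> H := 2^-1%:C *: (S + D); pose V : H -> H := 2^-1%:C *: (S - D).
have UE x : U x = 2^-1%:C *: (S x + D x) by rewrite /U !fctE.
have VE x : V x = 2^-1%:C *: (S x - D x) by rewrite /V !fctE.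
have hU : sop U by apply: sop_scale; exact: sop_add.
have hV : sop V by apply: sop_scale; exact: sop_sub.
clearbody U V.
have h2 : 0 <= 2^-1 :> R by rewrite invr_ge0.
have SD x : rdot (D x) (D x) <= rdot (S x) (S x).
  by rewrite (sopS _ _ hS) SS /= sopS.
have pU : psd U.
  move=> x; rewrite UE rdotZl mulr_ge0 // rdotDl -lerBlDr add0r -rdotNl.
  by apply: (loewner hS pS (sop_opp hD)) => y; rewrite fctE rdotNl rdotNr opprK.
have pV : psd V.
  move=> x; rewrite VE rdotZl mulr_ge0 // rdotDl rdotNl subr_ge0.
  exact: loewner.
have UV x : U (V x) = 0.
  rewrite UE VE !(sopZ _ _ hS, sopZ _ _ hD) !(sopB _ _ hS, sopB _ _ hD) SS DS
    /=.
  by apply: rdot_inj => z; rewrite !rdotE rdot0l; ring.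
have UVE x : D x = U x - V x.
  by rewrite UE VE; apply: rdot_inj => z; rewrite !rdotE; field.
have [c c0 hc] := sop_bound hU.
pose K : H -> H := idfun - c^-1%:C *: U.
have hK : sop K by apply: sop_sub; [exact: sop_id|exact: sop_scale].
have KE x : K x = x - c^-1%:C *: U x by rewrite /K !fctE.
clearbody K.
have pK : psd K.
  move=> x; rewrite KE rdotDl rdotNl rdotZl subr_ge0 mulrC ler_pdivrMr // mulrC.
  exact: rdot_bound.
have qK x : rdot (K x) x <= 1 * rdot x x.
  by rewrite KE rdotDl rdotNl rdotZl mul1r gerBl mulr_ge0 ?invr_ge0 ?(ltW c0)
    //; exact: pU.
have K1 x : nr (K x) <= nr x.
  by rewrite -[leRHS]mul1r; apply: psd_contraction.
have Kn1 n x : nr (iter n K x) <= nr x.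
  by elim: n => // n IH; rewrite iterS (le_trans (K1 _)).
pose T n : H -> H := - (iter n K \o iter n K).
have TE n x : T n x = - iter n K (iter n K x) by [].
have hT n : sop (T n) by apply: sop_opp; apply: sop_comp => //; exact: sop_iter.
have bT n x : nr (T n x) <= 1 * nr x.
  by rewrite TE nrN mul1r (le_trans (Kn1 _ _)).
have mT n : ple (T n) (T n.+1).
  move=> x; rewrite !TE !rdotNl lerN2 (sopS _ _ (sop_iter n hK)) (sopS _ _
    (sop_iter n.+1 hK)) !rdotxx iterS.
  by rewrite ler_pXn2r ?nnegrE ?nr_ge0 // K1.
have [L [hL _ _ lL]] := monotone_strong_limit hT bT mT.
pose P : H -> H := - L.
have hP : sop P by exact: sop_opp.
have lP x : lim_to (fun n => iter n K (iter n K x)) (P x).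
  have -> : P x = (-1) *: L x by rewrite scaleN1r.
  by apply: lim_to_ext (lim_to_scale (-1) (lL x)) => n;
    rewrite scaleN1r TE opprK.
clearbody P.
(* [y = P x] is fixed by [K^2], so [K y] is as long as [y]; but the squared norm of [K y] is at most
   the form of [K = 1 - U / c] at [y], which leaves no room for a positive form of [U]. *)
have UP x : U (P x) = 0.
  apply: psd_eq0 => //; set y := P x.
  have KKy : K (K y) = y.
    apply: (lim_to_uniq (lim_to_sop hK (lim_to_sop hK (lP x)))).
    apply: lim_to_ext (lim_to_shift (lP x)) => n.
    by rewrite !iterS -iterSr iterS.
  apply/eqP; rewrite eq_le pU andbT.
  have h1 : nr y ^+ 2 <= nr (K y) ^+ 2.
    by rewrite ler_pXn2r ?nnegrE ?nr_ge0 // -{1}KKy K1.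
  have := le_trans h1 (psd_nr_le y hK pK qK).
  rewrite mul1r KE rdotDl rdotNl rdotZl -rdotxx lerBrDl gerDr.
  by rewrite pmulr_rle0 // invr_gt0.
have Pfix x : U x = 0 -> P x = x.
  move=> Ux; have Kx : K x = x by rewrite KE Ux scaler0 subr0.
  have Kn n : iter n K x = x by elim: n => // n IH; rewrite iterS IH.
  apply: (lim_to_uniq (lP x)); apply: lim_to_ext (lim_to_cst x) => n.
  by rewrite !Kn.
have cP C : sop C -> commutes C E -> commutes C P.
  move=> hC cE.
  have cD : commutes C D by move=> x;
    rewrite !DE (sopB _ _ hC) (sopZ _ _ hC) cE.
  have cCS : commutes C S by apply: cS => // x /=; rewrite !cD.
  have cU : commutes C U.
    by move=> x; rewrite !UE (sopZ _ _ hC) (sopD _ _ hC) cCS cD.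
  have cK : commutes C K by move=> x;
    rewrite !KE (sopB _ _ hC) (sopZ _ _ hC) cU.
  apply: (commutes_lim hC lP) => n x.
  have cn y : C (iter n K y) = iter n K (C y).
    by elim: n {lP} => // n IH; rewrite !iterS cK IH.
  by rewrite !cn.
exists P; split => // [x|x|x Px].
- by rewrite Pfix.
- rewrite -subr_ge0 -rdotZl -rdotNl -rdotDl.
  have -> : t%:C *: P x - E (P x) = V (P x).
    by rewrite -opprB -DE UVE UP sub0r opprK.
  exact: pV.
(* [U V = 0], so [P] fixes the range of [V]; with commutation, [V x = P (V x) = V (P x) = 0]. *)
- have Vx : V x = 0.
    have -> : V x = P (V x) by rewrite Pfix.
    have cV : commutes V E.
      have cE : commutes D E by move=> y;
        rewrite !DE (sopB _ _ hE) (sopZ _ _ hE).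
      move=> y; rewrite !VE (sopZ _ _ hE) (sopB _ _ hE) cE; congr (_ *:
        (_ - _)).
      by symmetry; apply: cS => // z /=; rewrite -!cE.
    by rewrite -(cP _ hV cV) Px sop0.
  rewrite -subr_ge0 -rdotZl -rdotNl -rdotDl -DE UVE Vx subr0; exact: pU.
Qed.

End SpectralProjection.

(** * Positive invertible operators and geometric means *)

Section PositiveOperators.
Context {R : realType} {H : hilbertType R}.
Implicit Types (x y z : H) (a b c t : R) (S T A B C V X Y : H -> H).

Lemma bounded_opP T :
  bounded_op T <-> linear T /\ exists c, forall x, nr (T x) <= c * nr x.
Proof.
have pack : linear T -> exists f : {linear H -> H}, T = f.
  by move=> lT; exists (HB.pack_for {linear H -> H} T (GRing.isLinear.Build _ _
    _ _ T lT)).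
split=> [[lT cT]|[lT [c hc]]]; split=> //.
- have [f Tf] := pack lT; move: cT; rewrite Tf => /linear_bounded_continuous.
  move=> /linear_boundedP [y [yr hy]].
  have h1 : y < y + 1 by rewrite ltrDl.
  exists (complex.Re (y + 1)) => x; rewrite -lecR rmorphM /= -!normE.
  by rewrite RRe_real ?hy // realD ?real1.
- have [f Tf] := pack lT; rewrite Tf; apply/linear_bounded_continuous.
  apply/linear_boundedP; exists c%:C; split; first by rewrite complex_real.
  move=> M cM x; rewrite -Tf normE (le_trans (y := c%:C * `|x|)) //.
    by rewrite normE -rmorphM lecR.
  by rewrite ler_wpM2r // ltW.
Qed.

(** Multiplication by [i] recovers the imaginary part, so real symmetry of a complex-linear operator
    is full self-adjointness. *)
Lemma rdotiZ x y : rdot x ('i%C *: y) = complex.Im (hdot H x y).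
Proof.
rewrite /rdot linearZr_LR /=; case: (hdot H x y) => u v /=.
by rewrite mul0r mulN1r sub0r opprK.
Qed.

Lemma Im_hdotC x y : complex.Im (hdot H x y) = - complex.Im (hdot H y x).
Proof.
rewrite hermC expr0 mul1r; have h (w : R[i]) :
  complex.Im (Num.conj w) = - complex.Im w by case: w.
exact: h.
Qed.

Lemma sop_hdot T x : sop T -> hdot H (T x) x = (rdot (T x) x)%:C.
Proof.
move=> hT; apply/eqP; rewrite eq_complex /= eqxx /=.
have : complex.Im (hdot H (T x) x) = - complex.Im (hdot H (T x) x).
  by rewrite -{1}rdotiZ sopS // sopZ // rdotiZ Im_hdotC.
by move=> e; apply/eqP; lra.
Qed.

Lemma pleP X Y : sop X -> sop Y -> op_le X Y <-> ple X Y.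
Proof.
move=> hX hY; split=> h x; have := h x; have hD := sop_sub hY hX;
by rewrite sop_hdot // ler0c fctE rdotDl rdotNl subr_ge0.
Qed.

Lemma pos_opP A : pos_op A <-> sop A /\ psd A.
Proof.
split=> [[/bounded_opP[lA bA] pA]|[hA pA]]; last first.
  split; first by apply/bounded_opP; case: hA.
  apply/pleP => //; first exact: sop_0.
  by move=> x; rewrite (_ : (0 : H -> H) x = 0) // rdot0l; exact: pA.
have rA x : complex.Im (hdot H (A x) x) = 0.
  by have := pA x; rewrite subr0 => /ger0_Im.
have AD x y : A (x + y) = A x + A y by rewrite -[x]scale1r lA !scale1r.
have AZ k x : A (k *: x) = k *: A x.
  have A0 : A 0 = 0 by apply: (addrI (A 0)); rewrite -AD !addr0.
  by rewrite -[k *: x]addr0 lA A0 addr0.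
split.
  split=> // x y.
  (* Polarization: since the form is real at [x], [y] and [x + i y], the real parts of the two cross
     terms agree. *)
  have := rA (x + 'i%C *: y).
  rewrite AD AZ linearDl !linearDr !linearZl_LR !linearZr_LR /=.
  rewrite (rdotC x) /rdot; move: (rA x) (rA y); rewrite /GRing.scale /=.
  case: (hdot H (A x) x) (hdot H (A y) y) (hdot H (A x) y) (hdot H (A y) x)
    => [a1 b1] [a2 b2] [a3 b3] [a4 b4] /= -> -> /=.
  lra.
by move=> x; have := pA x; rewrite subr0 /rdot lecE => /andP[].
Qed.

Lemma inverse_sop A B : sop A -> inverse_op A B ->
  [/\ sop B, forall x, A (B x) = x & forall x, B (A x) = x].
Proof.
move=> hA [/bounded_opP[lB bB] AB BA].
have ABx x : A (B x) = x by have := congr1 (@^~ x) AB.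
have BAx x : B (A x) = x by have := congr1 (@^~ x) BA.
split=> //; split=> // x y.
by rewrite -{2}[x]ABx (sopS _ _ hA) ABx.
Qed.

Lemma sop_inverse A B : sop B -> (forall x, A (B x) = x) ->
  (forall x, B (A x) = x) -> inverse_op A B.
Proof.
move=> hB AB BA; split; [|exact/funext|exact/funext].
by apply/bounded_opP; case: hB.
Qed.

Lemma inverse_unique A B C : inverse_op A B -> inverse_op A C -> B = C.
Proof.
move=> [_ _ BA] [_ AC _].
by rewrite -[LHS]/(B \o idfun) -AC compA BA.
Qed.

(** If [B] inverts [A] with bound [b], then [x = B (A x)] is at most [b] times as long as [A x], and
    [A^2 <= a A] turns this into a lower bound of the form. The converse is the Neumann series. *)
Lemma pos_inv_opP A : pos_inv_op A <-> sop A /\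
  exists2 c, 0 < c & forall x, c * rdot x x <= rdot (A x) x.
Proof.
split=> [[/pos_opP[hA pA] [B AB]]|[hA [c c0 hc]]].
  split=> //; have [hB ABx BAx] := inverse_sop hA AB.
  have [b b0 hb] := sop_bound hB; have [a a0 ha] := sop_bound hA.
  exists (b ^+ 2 * a)^-1 => [|x]; first by rewrite invr_gt0 mulr_gt0 ?exprn_gt0.
  rewrite mulrC ler_pdivrMr ?mulr_gt0 ?exprn_gt0 // mulrC -mulrA.
  apply: le_trans (_ : b ^+ 2 * nr (A x) ^+ 2 <= _); last first.
    rewrite ler_pM2l ?exprn_gt0 //; apply: psd_nr_le => // y; exact: rdot_bound.
  rewrite rdotxx -exprMn ler_pXn2r ?nnegrE ?mulr_ge0 ?nr_ge0 ?(ltW b0) //.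
  by rewrite -{1}[x]BAx.
split.
  apply/pos_opP; split=> // x; apply: le_trans (hc x).
  by rewrite mulr_ge0 ?rdotxx_ge0 // ltW.
have [B [hB AB BA _]] := inverse_exists hA c0 hc.
by exists B; exact: sop_inverse.
Qed.

Lemma pos_inv_sop A : pos_inv_op A -> sop A.
Proof. by case/pos_inv_opP. Qed.

Lemma pos_inv_psd A : pos_inv_op A -> psd A.
Proof. by case=> /pos_opP[]. Qed.

Lemma pos_inv_ge A B : pos_inv_op A -> sop B -> ple A B -> pos_inv_op B.
Proof.
move=> /pos_inv_opP[hA [c c0 hc]] hB AB; apply/pos_inv_opP; split=> //.
by exists c => // x; rewrite (le_trans (hc x)).
Qed.

Lemma pos_inv_scale_id t : 0 < t -> pos_inv_op (t%:C *: idfun : H -> H).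
Proof.
move=> t0; apply/pos_inv_opP; split; first by apply: sop_scale; exact: sop_id.
by exists t => // x; rewrite fctE rdotZl.
Qed.

Lemma pos_inv_id : pos_inv_op (idfun : H -> H).
Proof. by have := pos_inv_scale_id ltr01; rewrite rmorph1 scale1r. Qed.

Lemma pos_inv_conj S V A : sop S -> sop V -> (forall x, V (S x) = x) ->
  pos_inv_op A -> pos_inv_op (S \o A \o S).
Proof.
move=> hS hV VS /pos_inv_opP[hA [c c0 hc]]; apply/pos_inv_opP.
split; first exact: sop_conj.
have [b b0 hb] := sop_bound hV.
(* [x = V (S x)] is at most [b] times as long as [S x]. *)
exists (c / b ^+ 2) => [|x]; first by rewrite divr_gt0 // exprn_gt0.
rewrite /= (sopS _ _ hS); apply: le_trans (hc (S x)).
rewrite -mulrA ler_pM2l // mulrC ler_pdivrMr ?exprn_gt0 //.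
rewrite !rdotxx mulrC -exprMn ler_pXn2r ?nnegrE ?mulr_ge0 ?nr_ge0 ?(ltW b0) //.
by rewrite -{1}[x]VS.
Qed.

Lemma op_sqrtP A : sop A -> psd A ->
  [/\ sop (op_sqrt A), psd (op_sqrt A) &
      forall x, op_sqrt A (op_sqrt A x) = A x].
Proof.
move=> hA pA; have [S [hS pS SS _]] := sqrt_exists hA pA.
have h : [set S | pos_op S /\ S \o S = A]%classic S.
  by split; [exact/pos_opP|exact/funext].
rewrite /op_sqrt; case: xgetP => [T _ [/pos_opP[hT pT] TT]|/(_ S h)[]].
by split=> // x; have := congr1 (@^~ x) TT.
Qed.

Lemma op_sqrt_commutes A C : sop A -> psd A -> sop C -> commutes C A ->
  commutes C (op_sqrt A).
Proof.
move=> hA pA hC cC; have [S [hS pS SS cS]] := sqrt_exists hA pA.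
have [hT pT TT] := op_sqrtP hA pA.
have -> : op_sqrt A = S by apply: sqrt_unique => // x; rewrite TT SS.
exact: cS.
Qed.

Lemma op_invE A B : inverse_op A B -> op_inv A = B.
Proof.
move=> h; rewrite /op_inv; case: xgetP => [C _ hC|/(_ B)//].
exact: inverse_unique hC h.
Qed.

End PositiveOperators.

(** * The geometric mean and its maximality *)

Section GeometricMean.
Context {R : realType} {H : hilbertType R}.
Implicit Types (x y z u v : H) (a b c t : R) (S T A B C V X Y Z : H -> H).

Lemma pos_inv_sqrt A (S := op_sqrt A) (V := op_inv S) : pos_inv_op A ->
  [/\ sop S /\ sop V, forall x, S (V x) = x, forall x, V (S x) = x &
      forall x, S (S x) = A x].
Proof.
move=> hA; have sA := pos_inv_sop hA.
have [sS pS SS] : [/\ sop S, psd S & forall x, S (S x) = A x].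
  exact: op_sqrtP (pos_inv_psd hA).
have [_ [B AB]] := hA; have [sB ABx BAx] := inverse_sop sA AB.
have cS : commutes S A by move=> x; rewrite -!SS.
have SB x : S (B x) = B (S x) by rewrite -{2}[x]ABx cS BAx.
(* The inverse of the square root is [A^(1/2) A^(-1)]; here [B] denotes the inverse of [A]. *)
have hSB : inverse_op S (S \o B).
  apply: sop_inverse => [|x|x] /=; first exact: sop_comp.
    by rewrite SS ABx.
  by rewrite SB SS BAx.
have -> : V = S \o B by exact: op_invE.
split=> [|x|x|//] /=; first by split=> //; exact: sop_comp.
  by rewrite SS ABx.
by rewrite SB SS BAx.
Qed.

(* Positivity of the operator matrix [[A, Z], [Z, B]] on [H + H]; the geometric
   mean is the largest [Z] for which it holds. *)
Definition psd_block A Z B : Prop := forall u v,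
  0 <= rdot (A u) u + 2 * rdot (Z v) u + rdot (B v) v.

Section Maximality.
Variables A B : H -> H.
Hypotheses (hA : pos_inv_op A) (hB : pos_inv_op B).

Lemma pos_inv_whiten (V := op_inv (op_sqrt A)) : pos_inv_op (V \o B \o V).
Proof.
have [[sS sV] SV VS SS] := pos_inv_sqrt hA.
exact: pos_inv_conj sV sS SV hB.
Qed.

(** Gives access to [S = A^(1/2)], [V = A^(-1/2)] and [r = (V B V)^(1/2)] through their algebraic
    relations only. *)
Lemma geom_mean_factor : exists S V r,
  [/\ sop S, sop V, forall x, S (V x) = x, forall x, V (S x) = x &
      forall x, S (S x) = A x] /\
  [/\ sop r, psd r, forall x, r (r x) = V (B (V x)) &
      geom_mean A B = S \o r \o S].
Proof.
exists (op_sqrt A), (op_inv (op_sqrt A)).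
exists (op_sqrt (op_inv (op_sqrt A) \o B \o op_inv (op_sqrt A))).
have [[sS sV] SV VS SS] := pos_inv_sqrt hA; split; first by split.
by have [] := op_sqrtP (pos_inv_sop pos_inv_whiten) (pos_inv_psd
  pos_inv_whiten).
Qed.

Lemma sop_geom_mean : sop (geom_mean A B).
Proof.
have [S [V [r [[sS _ _ _ _] [sr _ _ ->]]]]] := geom_mean_factor.
exact: sop_conj.
Qed.

Lemma psd_geom_mean : psd (geom_mean A B).
Proof.
have [S [V [r [[sS _ _ _ _] [_ pr _ ->]]]]] := geom_mean_factor.
by move=> x; rewrite /= (sopS _ _ sS).
Qed.

(** As [A = S^2] and [B = S r^2 S], the form is the squared norm of [S u + r (S v)]. *)
Lemma psd_block_geom_mean : psd_block A (geom_mean A B) B.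
Proof.
have [S [V [r [[sS _ SV VS SS] [sr _ rr ->]]]]] := geom_mean_factor.
move=> u v /=.
have -> : B v = S (r (r (S v))) by rewrite rr SV VS.
rewrite -SS (sopS (S u) _ sS) (sopS (r (S v)) u sS) (sopS _ v sS).
rewrite (sopS (r (S v)) _ sr).
have := rdotxx_ge0 (S u + r (S v)).
by rewrite !rdotE (rdotC (S u) (r _)); congr (_ <= _); ring.
Qed.

(** After whitening, the block condition says that the square of [V Z V] is at most [r^2]; [loewner]
    then removes the squares. *)
Lemma geom_mean_max Z : sop Z -> psd_block A Z B -> ple Z (geom_mean A B).
Proof.
move=> hZ hb.
have [S [V [r [[sS sV SV VS SS] [sr pr rr ->]]]]] := geom_mean_factor.
have hX : sop (V \o Z \o V) by exact: sop_conj.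
have : ple (V \o Z \o V) r.
  apply: loewner => // x; set w := (V \o Z \o V) x.
  (* The first vector minimizes the block form once the second is [V x]. *)
  have := hb (- V w) (V x).
  rewrite (sopS _ _ sr) rr /= -(sopS _ _ sV).
  rewrite (sopN _ (pos_inv_sop hA)) !rdotNl !rdotNr opprK -SS SV (sopS _ _ sS)
    SV.
  rewrite -(sopS _ _ sV) -[V (Z (V x))]/w (sopS _ _ sV).
  rewrite [rdot x _]rdotC (sopS (B (V x)) x sV); lra.
move=> h x; have := h (S x); rewrite /= (sopS _ _ sV) VS.
by rewrite (sopS (r (S x)) x sS).
Qed.

End Maximality.

Lemma psd_block_sym A Z B : sop Z -> psd_block A Z B -> psd_block B Z A.
Proof.
move=> hZ h u v; have := h v u; rewrite (sopS _ _ hZ) (rdotC u).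
by congr (_ <= _); ring.
Qed.

End GeometricMean.

(** * Spectral comparison and operator means *)

Section Projections.
Context {R : realType} {H : hilbertType R}.
Implicit Types (x y z u v : H) (a b c s t : R) (S T A B C V X Y Z E P Q :
  H -> H).

Definition proj_op P : Prop := sop P /\ forall x, P (P x) = P x.

Lemma proj_compl P : proj_op P -> proj_op (idfun - P).
Proof.
move=> [hP PP]; split=> [|x]; first by apply: sop_sub hP; exact: sop_id.
by rewrite -[LHS]/((x - P x) - P (x - P x)) (sopB _ _ hP) PP subrr subr0.
Qed.

(** [Z] preserves the range and the kernel of [P], so the cross terms vanish. *)
Lemma rdot_proj_split P Z x : proj_op P -> sop Z -> commutes P Z ->
  rdot (Z x) x = rdot (Z (P x)) (P x) + rdot (Z (x - P x)) (x - P x).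
Proof.
move=> [hP PP] hZ cP.
have e : rdot (Z (P x)) x = rdot (Z (P x)) (P x).
  by rewrite -{1}PP -cP (sopS _ _ hP).
have e' : rdot (Z x) (P x) = rdot (Z (P x)) (P x).
  by rewrite -(sopS _ _ hP) cP.
by rewrite (sopB _ _ hZ) !rdotE e e'; ring.
Qed.

Definition bounds_on E P s t : Prop := forall x,
  s * rdot (P x) (P x) <= rdot (E (P x)) (P x) <= t * rdot (P x) (P x).

(* [Z] behaves like [phi(E)], as far as the spectral projections of [E] tell;
   [phi] is meant to be nondecreasing. *)
Definition represents E Z (phi : R -> R) : Prop := sop Z /\
  forall P, proj_op P -> commutes P E -> commutes P Z /\
    forall s t, 0 < s -> 0 < t -> bounds_on E P s t ->
      bounds_on Z P (phi s) (phi t).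

Lemma represents_self E : sop E -> represents E E id.
Proof. by move=> hE; split=> // P _ cP; split=> // s t _ _ b x; exact: b. Qed.

Lemma represents_id E : represents E idfun (fun=> 1).
Proof.
split; first exact: sop_id.
by move=> P _ _; split=> // s t _ _ _ x; rewrite mul1r lexx.
Qed.

Lemma represents_add E Y Z phi psi : represents E Y phi -> represents E Z psi ->
  represents E (Y + Z) (fun t => phi t + psi t).
Proof.
move=> [hY rY] [hZ rZ]; split; first exact: sop_add.
move=> P pP cP; have [cY bY] := rY P pP cP; have [cZ bZ] := rZ P pP cP.
split=> [x|s t s0 t0 b x]; first by rewrite !fctE (sopD _ _ pP.1) cY cZ.
have /andP[b1 b2] := bY s t s0 t0 b x; have /andP[b3 b4] := bZ s t s0 t0 b x.
by rewrite fctE rdotDl !mulrDl !lerD.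
Qed.

Lemma represents_scale E Z phi a : 0 <= a -> represents E Z phi ->
  represents E (a%:C *: Z) (fun t => a * phi t).
Proof.
move=> a0 [hZ rZ]; split; first exact: sop_scale.
move=> P pP cP; have [cZ bZ] := rZ P pP cP.
split=> [x|s t s0 t0 b x]; first by rewrite !fctE (sopZ _ _ pP.1) cZ.
have /andP[b1 b2] := bZ s t s0 t0 b x.
by rewrite fctE rdotZl -!mulrA !ler_wpM2l.
Qed.

(** On the range of [P], compare [r] with [sqrt s] and [sqrt t] by [loewner]; the corresponding
    squares are ordered by hypothesis. *)
Lemma represents_sqrt E : sop E -> psd E -> represents E (op_sqrt E) Num.sqrt.
Proof.
move=> hE pE; have [hr pr rr] := op_sqrtP hE pE;
  set r := op_sqrt E in hr pr rr *.
split=> // P [hP PP] cP.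
have cr : commutes P r by exact: op_sqrt_commutes.
split=> // s t s0 t0 b x.
have sr : sop (r \o P) by apply: sop_comp => // y; rewrite cr.
have pr' : psd (r \o P).
  by move=> y; rewrite /= -[P y]PP -cr (sopS _ _ hP); exact: pr.
have sq c : 0 <= c -> Num.sqrt c * Num.sqrt c = c by move=> c0;
  rewrite -expr2 sqr_sqrtr.
have sP c : sop (c%:C *: P) by exact: sop_scale.
have rE y : rdot (r (P y)) (r (P y)) = rdot (E (P y)) (P y).
  by rewrite -rr (sopS (r (P y)) _ hr).
have PE c y : rdot ((c%:C *: P) y) y = c * rdot (P y) (P y).
  by rewrite fctE rdotZl -{1}PP (sopS _ _ hP).
have rPE y : rdot ((r \o P) y) y = rdot (r (P y)) (P y).
  by rewrite /= -{1}[P y]PP -cr (sopS _ _ hP).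
have PN c y : 0 <= c -> rdot (((Num.sqrt c)%:C *: P) y) (((Num.sqrt c)%:C *:
  P) y)
    = c * rdot (P y) (P y).
  by move=> c0; rewrite !fctE rdotZl rdotZr mulrA sq.
apply/andP; split; rewrite -PE -rPE.
  apply: loewner => // y; rewrite (PN _ _ (ltW s0)) /= rE.
  by have /andP[] := b y.
have pP : psd ((Num.sqrt t)%:C *: P).
  by move=> y; rewrite PE mulr_ge0 ?sqrtr_ge0 ?rdotxx_ge0.
apply: loewner => // y; rewrite (PN _ _ (ltW t0)) /= rE.
by have /andP[] := b y.
Qed.

(* Cut the spectrum of [E] at the points [m + k eta]; on each piece the bounds
   hold up to the factor [1 + eta / m]. *)
Lemma represents_le E Y Z (phi psi : R -> R) m M :
  sop E -> 0 < m -> m <= M -> bounds_on E idfun m M ->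
  represents E Y phi -> represents E Z psi ->
  (forall t, m <= t <= M -> 0 <= psi t) ->
  (forall t, m <= t <= M -> phi t <= psi t) ->
  (forall s t, 0 < s -> s <= t -> phi t <= t / s * phi s) ->
  ple Y Z.
Proof.
move=> hE m0 mM bE [hY rY] [hZ rZ] psi0 phi_psi phi_sub.
(* On a piece where [s <= E <= t]: [Y <= phi t <= (t / s) phi s <= (t / s) psi s <= (t / s) Z]. *)
have piece P s t : proj_op P -> commutes P E -> m <= s <= M -> s <= t ->
    bounds_on E P s t -> forall r, t / s <= r -> forall x,
    rdot (Y (P x)) (P x) <= r * rdot (Z (P x)) (P x).
  move=> pP cP /andP[ms sM] st b r tr x.
  have s0 : 0 < s by exact: lt_le_trans ms.
  have t0 : 0 < t by exact: lt_le_trans st.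
  have sMM : m <= s <= M by rewrite ms.
  have [_ bY] := rY P pP cP; have [_ bZ] := rZ P pP cP.
  have /andP[_ b1] := bY s t s0 t0 b x; have /andP[b2 _] := bZ s t s0 t0 b x.
  apply: le_trans b1 _; have := rdotxx_ge0 (P x);
    set q := rdot (P x) (P x) => q0.
  have r0 : 0 <= r by apply: le_trans tr; rewrite divr_ge0 ?ltW.
  apply: le_trans (_ : r * (psi s * q) <= _); last by rewrite ler_wpM2l.
  rewrite mulrA ler_wpM2r // (le_trans (phi_sub s t s0 st)) //.
  apply: le_trans (_ : t / s * psi s <= _);
    first by rewrite ler_wpM2l ?phi_psi // divr_ge0 ?ltW.
  by rewrite ler_wpM2r ?psi0.
have main N : (0 < N)%N -> forall x,
    rdot (Y x) x <= (1 + (M - m) / N%:R / m) * rdot (Z x) x.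
  move=> N0; set eta := _ / N%:R.
  have NR : 0 < N%:R :> R by rewrite ltr0n.
  have eta0 : 0 <= eta by rewrite divr_ge0 ?subr_ge0.
  pose cut k : R := m + k%:R * eta.
  have cutS k : cut k.+1 = cut k + eta by rewrite /cut -natr1; ring.
  have cutm k : m <= cut k by rewrite lerDl mulr_ge0.
  have cutM k : (k <= N)%N -> cut k <= M.
    move=> kN; have : k%:R * eta <= N%:R * eta by rewrite ler_wpM2r ?ler_nat.
    by rewrite /cut /eta (mulrC N%:R) divfK ?gt_eqF // => ?; lra.
  (* Induction on the number of pieces below [cut k]. The spectral projection [Q] at the previous
     cut splits off the top piece, and the rest goes to the induction hypothesis. At [k = 0] the
     piece is the single point [m]. *)
  have ind k : (k <= N)%N -> forall P, proj_op P -> commutes P E ->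
      bounds_on E P m (cut k) -> forall x,
      rdot (Y (P x)) (P x) <= (1 + eta / m) * rdot (Z (P x)) (P x).
    elim: k => [|k IH] kN P pP cP b x.
      apply: (piece P m (cut 0%N)) => //; first by rewrite lexx.
      by rewrite /cut mul0r addr0 divff ?gt_eqF // lerDl divr_ge0 // ltW.
    have [Q [hQ QQ cQ Qle Qge]] := spectral_projection (cut k) hE.
    have pQ : proj_op Q by [].
    have cQE : commutes Q E by move=> y; rewrite (cQ E).
    have cPQ : commutes P Q by exact: cQ pP.1 cP.
    rewrite (rdot_proj_split (P x) pQ hY (rY Q pQ cQE).1).
    rewrite (rdot_proj_split (P x) pQ hZ (rZ Q pQ cQE).1) mulrDr.
    have [hP PP] := pP.
    apply: lerD.
      have e y : (Q \o P) y = Q (P y) by [].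
      rewrite -e; apply: (IH (ltnW kN)).
      - split=> [|y /=]; first exact: sop_comp.
        by rewrite cPQ PP QQ.
      - by move=> y /=; rewrite cP cQE.
      - move=> y /=; rewrite Qle andbT -cPQ.
        by have /andP[] := b (Q y).
    have e y : (P \o (idfun - Q)) y = P y - Q (P y).
      by rewrite /= !fctE /= (sopB _ _ hP) cPQ.
    rewrite -e; apply: (piece _ (cut k) (cut k.+1)).
    - have [hQ' QQ'] := proj_compl pQ.
      have cPQ' : commutes P (idfun - Q).
        by move=> y; rewrite !fctE /= (sopB _ _ hP) cPQ.
      by split=> [|y /=]; [exact: sop_comp|rewrite -cPQ' PP QQ'].
    - by move=> y; rewrite !e (sopB _ _ hE) cP cQE.
    - by rewrite cutm cutM // ltnW.
    - by rewrite cutS lerDl.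
    - move=> y; apply/andP; split; last by have /andP[] := b ((idfun - Q) y).
      by apply: Qge; rewrite e (sopB _ _ hQ) QQ subrr.
    (* Consecutive cuts have ratio [1 + eta / cut k], at most [1 + eta / m]. *)
    - rewrite cutS mulrDl divff ?gt_eqF ?(lt_le_trans m0) // lerD2l.
      by rewrite ler_wpM2l // lef_pV2 ?posrE // (lt_le_trans m0).
  move=> x; apply: (ind N (leqnn N) idfun) => //.
    by split=> //; exact: sop_id.
  by rewrite /cut /eta (mulrC N%:R) divfK ?gt_eqF // (_ : m + (M - m) = M) //;
    ring.
move=> x; apply/ler_addgt0Pr => e e0.
(* The error with [N] pieces is [w / N], which becomes less than [e]. *)
pose w := (M - m) / m * rdot (Z x) x.
have [N hN] : exists N : nat, `|w| / e < N.+1%:R.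
  by exists (Num.truncn (`|w| / e)); exact: truncnS_gt.
have N0 : 0 < N.+1%:R :> R by rewrite ltr0n.
apply: le_trans (main N.+1 isT x) _.
rewrite mulrDl mul1r lerD2l.
have -> : (M - m) / N.+1%:R / m * rdot (Z x) x = w / N.+1%:R.
  by rewrite /w; field; rewrite !gt_eqF // -natr1.
rewrite ler_pdivrMr // (le_trans (ler_norm _)) //.
by move: hN; rewrite ltr_pdivrMr // mulrC => /ltW.
Qed.

End Projections.

(** * An operator mean on one Hilbert space *)

Section MeanOnSpace.
Context {R : realType} {H : hilbertType R}.
Variables (sigma : (H -> H) -> (H -> H) -> H -> H) (f : R -> R).
Hypothesis hsigma : operator_mean_on sigma.
Hypothesis hf : forall t, 0 < t ->
  sigma idfun (t%:C *: idfun) = (f t)%:C *: idfun.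
Implicit Types (x y z u v : H) (a b c s t : R) (S T A B C V X Y Z E P Q :
  H -> H).

Lemma sop_adjoint T : sop T -> adjoint_op T T.
Proof.
move=> hT x y; apply/eqP; rewrite eq_complex.
rewrite -[X in X == _]/(rdot (T x) y) -[X in X == _]/(rdot (T x) y) sopS //
  eqxx /=.
by rewrite -!rdotiZ sopS // sopZ.
Qed.

Lemma sop_bounded_op T : sop T -> bounded_op T.
Proof. by move=> hT; apply/bounded_opP; case: hT. Qed.

Lemma mean_sop A B : pos_inv_op A -> pos_inv_op B -> sop (sigma A B).
Proof. by move=> hA hB; apply: pos_inv_sop; exact: mean_pos_inv. Qed.

Lemma mean_transformer_ple T V A B :
  sop T -> sop V -> (forall x, V (T x) = x) ->
  pos_inv_op A -> pos_inv_op B ->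
  ple (T \o sigma A B \o T) (sigma (T \o A \o T) (T \o B \o T)).
Proof.
move=> hT hV VT hA hB.
have hTA := pos_inv_conj hT hV VT hA; have hTB := pos_inv_conj hT hV VT hB.
apply/pleP; [by apply: sop_conj => //; exact: mean_sop|exact: mean_sop|].
by apply: (mean_transformer hsigma) => //; [exact: sop_bounded_op|exact:
  sop_bounded_op|exact: sop_adjoint].
Qed.

(** One direction is the transformer inequality for [T]; the other is the same inequality for the
    inverse [V], read at [T x]. *)
Lemma mean_congruence T V A B : sop T -> sop V ->
  (forall x, V (T x) = x) -> (forall x, T (V x) = x) ->
  pos_inv_op A -> pos_inv_op B ->
  sigma (T \o A \o T) (T \o B \o T) = T \o sigma A B \o T.
Proof.
move=> hT hV VT TV hA hB.
have hTA := pos_inv_conj hT hV VT hA; have hTB := pos_inv_conj hT hV VT hB.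
apply: ple_antisym; [exact: mean_sop|by apply: sop_conj => //; exact:
  mean_sop| |].
  have cancel C : V \o (T \o C \o T) \o V = C by apply/funext => x /=;
    rewrite TV VT.
  move=> x; have := mean_transformer_ple hV hT TV hTA hTB (T x).
  by rewrite !cancel /= (sopS _ _ hV) VT -(sopS _ _ hT).
exact: mean_transformer_ple hT hV VT hA hB.
Qed.

Lemma mean_ple A B C D : pos_inv_op A -> pos_inv_op B -> pos_inv_op C ->
  pos_inv_op D -> ple A C -> ple B D -> ple (sigma A B) (sigma C D).
Proof.
move=> hA hB hC hD AC BD; apply/pleP; [exact: mean_sop|exact: mean_sop|].
by apply: (mean_monotone hsigma) => //; apply/pleP => //; exact: pos_inv_sop.
Qed.

Section AgainstIdentity.
Variable E : H -> H.
Hypothesis hE : pos_inv_op E.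
Let sE := pos_inv_sop hE.

(** The reflection [U = 2 P - 1] fixes the identity and [E] under congruence, hence also their mean;
    so the mean commutes with [U] and with [P]. *)
Lemma mean_commutes P : proj_op P -> commutes P E ->
  commutes P (sigma idfun E).
Proof.
move=> [hP PP] cP; pose U : H -> H := 2%:C *: P - idfun.
have UE x : U x = 2%:C *: P x - x by rewrite /U !fctE.
have hU : sop U by apply: sop_sub; [exact: sop_scale|exact: sop_id].
have UU x : U (U x) = x.
  rewrite !UE (sopB _ _ hP) (sopZ _ _ hP) PP.
  by apply: rdot_inj => z; rewrite !rdotE; ring.
have e := mean_congruence hU hU UU UU pos_inv_id hE.
have e1 : U \o idfun \o U = idfun by apply/funext => x; exact: UU.
have e2 : U \o E \o U = E.
  apply/funext => x /=; rewrite -[RHS]UU; congr (U _).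
  by rewrite !UE (sopB _ _ sE) (sopZ _ _ sE) cP.
rewrite e1 e2 in e; move=> x; set F := sigma idfun E in e *.
have hF : sop F by apply: mean_sop => //; exact: pos_inv_id.
have : U (F x) = F (U x) by rewrite [in LHS]e /= UU.
rewrite !UE (sopB _ _ hF) (sopZ _ _ hF) => /addIr h.
have two0 : 2%:C != 0 :> R[i] by rewrite eq_complex /= eqxx andbT pnatr_eq0.
by apply: (scalerI two0).
Qed.

Lemma spectral_scaling P a : proj_op P -> 0 < a -> exists T V,
  [/\ sop T /\ sop V, forall x, V (T x) = x, forall x, T (V x) = x &
      forall x, T x = P x + a%:C *: (x - P x)].
Proof.
move=> [hP PP] a0.
pose D b : H -> H := P + b%:C *: (idfun - P).
have DE b x : D b x = P x + b%:C *: (x - P x) by rewrite /D !fctE.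
have hD b : sop (D b).
  by apply: sop_add => //; apply: sop_scale; apply: sop_sub => //;
    exact: sop_id.
have DD b c x : b * c = 1 -> D b (D c x) = x.
  move=> bc; rewrite !DE (sopD _ _ hP) (sopZ _ _ hP) (sopB _ _ hP) PP subrr
    scaler0 addr0.
  apply: rdot_inj => z; rewrite !rdotE.
  set p := rdot (P x) z; set q := rdot x z.
  by transitivity (p + (b * c) * (q - p)); [ring|rewrite bc; ring].
exists (D a), (D a^-1); split => [|x|x|x].
- by split.
- by rewrite DD // mulVf // gt_eqF.
- by rewrite DD // mulfV // gt_eqF.
- exact: DE.
Qed.

(* Compare [E] with [t T^2], where [T] is the identity on the range of [P] and a
   large multiple of the identity on its kernel. *)
Lemma mean_le_on P t : proj_op P -> commutes P E -> 0 < t ->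
  (forall x, rdot (E (P x)) (P x) <= t * rdot (P x) (P x)) ->
  forall x, rdot (sigma idfun E (P x)) (P x) <= f t * rdot (P x) (P x).
Proof.
move=> pP cP t0 hb x; have [hP PP] := pP.
have [c c0 hc] := sop_bound sE.
(* Large enough for [a^2 >= 1] and [t a^2 >= c], which give [1 <= T^2] and [E <= t T^2]. *)
pose a := 1 + c / t.
have a0 : 0 < a by rewrite ltr_wpDr // divr_ge0 ?ltW.
have a1 : 1 <= a ^+ 2 by rewrite exprn_ege1 // lerDl divr_ge0 ?ltW.
have a2 : c <= t * a ^+ 2.
  apply: le_trans (_ : t * a <= _).
    by rewrite mulrDr mulrCA mulfV ?gt_eqF // !mulr1 lerDr ltW.
  by rewrite ler_pM2l // expr2 ler_peMl ?ltW // /a ltrDl divr_gt0.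
have [T [V [[hT hV] VT TV TE]]] := spectral_scaling pP a0.
have tp := pos_inv_scale_id (H := H) t0.
have nT y : rdot (T y) (T y) = rdot (P y) (P y) + a ^+ 2 * rdot (y - P y) (y -
  P y).
  have e : rdot (P y) (y - P y) = 0.
    by rewrite -{1}PP (sopS _ _ hP) (sopB _ _ hP) PP subrr rdot0r.
  rewrite TE; move: (y - P y) e => q e.
  by rewrite !rdotE (rdotC q) e; ring.
have pyth y : rdot y y = rdot (P y) (P y) + rdot (y - P y) (y - P y).
  by have := @rdot_proj_split _ _ P idfun y pP sop_id (fun _ => erefl).
have h1 : ple idfun (T \o idfun \o T).
  move=> y; rewrite /= (sopS _ _ hT) nT [leLHS]pyth lerD2l ler_peMl //.
  exact: rdotxx_ge0.
have h2 : ple E (T \o (t%:C *: idfun) \o T).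
  move=> y; rewrite /= (sopS _ _ hT) fctE rdotZl nT mulrDr.
  rewrite (rdot_proj_split y pP sE cP) lerD //.
  apply: le_trans (rdot_bound _ hc) _.
  by rewrite mulrA ler_wpM2r // rdotxx_ge0.
have hTT := pos_inv_conj hT hV VT pos_inv_id.
have hTt := pos_inv_conj hT hV VT tp.
have := mean_ple pos_inv_id hE hTT hTt h1 h2 (P x).
rewrite (mean_congruence hT hV VT TV pos_inv_id tp) hf //= (sopS _ _ hT) fctE.
by rewrite rdotZl nT PP subrr rdot0l mulr0 addr0.
Qed.

(** Here [E] itself is dilated on the kernel of [P]: [1 <= T^2] and [s <= T E T]. Monotonicity and
    congruence bound [T (I sigma E) T] below by [f s], and [T] is the identity on the range of
    [P]. *)
Lemma mean_ge_on P s : proj_op P -> commutes P E -> 0 < s ->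
  (forall x, s * rdot (P x) (P x) <= rdot (E (P x)) (P x)) ->
  forall x, f s * rdot (P x) (P x) <= rdot (sigma idfun E (P x)) (P x).
Proof.
move=> pP cP s0 hb x; have [hP PP] := pP.
have /pos_inv_opP[_ [c c0 hc]] := hE.
pose a := 1 + s / c.
have a0 : 0 < a by rewrite ltr_wpDr // divr_ge0 ?ltW.
have a1 : 1 <= a ^+ 2 by rewrite exprn_ege1 // lerDl divr_ge0 ?ltW.
have a2 : s <= c * a ^+ 2.
  apply: le_trans (_ : c * a <= _).
    by rewrite mulrDr mulrCA mulfV ?gt_eqF // !mulr1 lerDr ltW.
  by rewrite ler_pM2l // expr2 ler_peMl ?ltW // /a ltrDl divr_gt0.
have [T [V [[hT hV] VT TV TE]]] := spectral_scaling pP a0.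
have sp := pos_inv_scale_id (H := H) s0.
have PT y : P (T y) = P y.
  by rewrite TE (sopD _ _ hP) (sopZ _ _ hP) (sopB _ _ hP) PP subrr scaler0
    addr0.
have cPT : commutes P T.
  by move=> y; rewrite PT TE PP subrr scaler0 addr0.
have QT y : T y - P y = a%:C *: (y - P y) by rewrite TE addrC addKr.
have pyth y : rdot y y = rdot (P y) (P y) + rdot (y - P y) (y - P y).
  by have := @rdot_proj_split _ _ P idfun y pP sop_id (fun _ => erefl).
have h1 : ple idfun (T \o idfun \o T).
  move=> y; rewrite /= (sopS _ _ hT) [leLHS]pyth [leRHS]pyth PT QT.
  rewrite rdotZl rdotZr lerD2l mulrA -expr2 ler_peMl //; exact: rdotxx_ge0.
have h2 : ple (s%:C *: idfun) (T \o E \o T).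
  move=> y; rewrite /= (sopS _ _ hT) fctE rdotZl [rdot y y]pyth mulrDr.
  rewrite (rdot_proj_split (T y) pP sE cP) PT QT lerD //.
  apply: le_trans (hc _).
  rewrite rdotZl rdotZr !mulrA -[c * a * a]mulrA -expr2.
  by rewrite ler_wpM2r // rdotxx_ge0.
have hTT := pos_inv_conj hT hV VT pos_inv_id.
have hTE := pos_inv_conj hT hV VT hE.
have := mean_ple pos_inv_id sp hTT hTE h1 h2 (P x).
rewrite (mean_congruence hT hV VT TV pos_inv_id hE) hf //= (sopS _ _ hT) fctE.
have -> : T (P x) = P x by rewrite -cPT PT.
by rewrite rdotZl.
Qed.

Lemma represents_mean : represents E (sigma idfun E) f.
Proof.
split; first by apply: mean_sop => //; exact: pos_inv_id.
move=> P pP cP; split; first exact: mean_commutes.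
move=> s t s0 t0 b x; apply/andP; split.
  by apply: mean_ge_on => // y; have /andP[] := b y.
by apply: mean_le_on => // y; have /andP[] := b y.
Qed.

End AgainstIdentity.

Lemma mean_factor A B S V : pos_inv_op A -> pos_inv_op B -> sop S -> sop V ->
  (forall x, S (V x) = x) -> (forall x, V (S x) = x) ->
  (forall x, S (S x) = A x) ->
  sigma A B = S \o sigma idfun (V \o B \o V) \o S.
Proof.
move=> hA hB hS hV SV VS SS.
rewrite -(mean_congruence hS hV VS SV pos_inv_id (pos_inv_conj hV hS SV hB)).
congr sigma; apply/funext => x /=; first by rewrite SS.
by rewrite SV VS.
Qed.

End MeanOnSpace.

(** * Concavity of the representing function *)

Section DirectSum.
Context {R : realType} (H : hilbertType R).

(** A copy of the product under a new name, so that it can carry the Euclidean norm in place of the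
    maximum norm. *)
Definition dsum : Type := (H * H)%type.
HB.instance Definition _ := GRing.Lmodule.copy dsum (H * H)%type.

Definition dsum_dot (x y : dsum) : R[i] := hdot H x.1 y.1 + hdot H x.2 y.2.

Lemma dsum_dot_bilinear :
  bilinear_for *%R (Num.conj \; *%R) dsum_dot.
Proof.
have e (p a b c d : R[i]) : p * a + b + (p * c + d) = p * (a + c) + (b + d).
  by rewrite mulrDr addrACA.
split=> [y|x] k u v.
  by rewrite /dsum_dot /= !linearDl !linearZl_LR; exact: (e k).
by rewrite /dsum_dot /= !linearDr !linearZr_LR /=; exact: addrACA.
Qed.

HB.instance Definition _ := bilinear_isBilinear.Build R[i] dsum dsum R[i]
  *%R (Num.conj \; *%R) dsum_dot dsum_dot_bilinear.

Lemma dsum_dot_hermitian x y :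
  dsum_dot x y = (-1) ^+ false * Num.conj (dsum_dot y x).
Proof.
rewrite expr0 mul1r /dsum_dot rmorphD; congr (_ + _);
by rewrite hermC expr0 mul1r.
Qed.

HB.instance Definition _ := isHermitianSesquilinear.Build R[i] dsum false
  Num.conj dsum_dot dsum_dot_hermitian.

Lemma dsum_dotxx x :
  dsum_dot x x = (nr x.1 ^+ 2 + nr x.2 ^+ 2)%:C.
Proof. by rewrite /dsum_dot !hdot_norm !normE rmorphD !rmorphXn. Qed.

Lemma dsum_dot_gt0 (x : dsum) : x != 0 -> 0 < dsum_dot x x.
Proof.
move=> x0; rewrite dsum_dotxx ltcR lt_def addr_ge0 ?sqr_ge0 // andbT.
apply: contraNneq x0 => /eqP.
rewrite paddr_eq0 ?sqr_ge0 // !sqrf_eq0 => /andP[/eqP/nr_eq0 e1 /eqP/nr_eq0 e2].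
by rewrite [x]surjective_pairing e1 e2.
Qed.

HB.instance Definition _ := isDotProduct.Build R[i] dsum dsum_dot dsum_dot_gt0.

Definition dsum_nr (x : dsum) : R := Num.sqrt (nr x.1 ^+ 2 + nr x.2 ^+ 2).

Lemma dsum_nr_ge (x : dsum) : nr x.1 <= dsum_nr x /\ nr x.2 <= dsum_nr x.
Proof.
by split; rewrite -[leLHS]ger0_norm ?nr_ge0 // -sqrtr_sqr ler_wsqrtr //
  ?lerDl ?lerDr sqr_ge0.
Qed.

Lemma dsum_nr_le (x : dsum) : dsum_nr x <= nr x.1 + nr x.2.
Proof.
have h1 := nr_ge0 x.1; have h2 := nr_ge0 x.2.
rewrite -[leRHS]ger0_norm ?addr_ge0 // -sqrtr_sqr ler_wsqrtr // sqrrD.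
by rewrite -addrA [X in _ <= _ + X]addrC addrA lerDl mulrn_wge0 // mulr_ge0.
Qed.

Lemma dsum_nrD (x y : dsum) : dsum_nr (x + y) <= dsum_nr x + dsum_nr y.
Proof.
rewrite /dsum_nr /=.
have := nrD x.1 y.1; have := nrD x.2 y.2.
have := nr_ge0 (x.1 + y.1); have := nr_ge0 (x.2 + y.2).
have := nr_ge0 x.1; have := nr_ge0 x.2; have := nr_ge0 y.1; have := nr_ge0 y.2.
move: (nr (x.1 + y.1)) (nr (x.2 + y.2)) (nr x.1) (nr x.2) (nr y.1) (nr y.2).
move=> p q a b c d d0 c0 b0 a0 q0 p0 qbd pac.
have sa : 0 <= a ^+ 2 + b ^+ 2 by rewrite addr_ge0 ?sqr_ge0.
have sc : 0 <= c ^+ 2 + d ^+ 2 by rewrite addr_ge0 ?sqr_ge0.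
(* Cauchy-Schwarz in the plane, from the Lagrange identity with remainder [(a d - b c)^2]. *)
have cs : a * c + b * d <= Num.sqrt (a ^+ 2 + b ^+ 2) * Num.sqrt (c ^+ 2 + d ^+
  2).
  rewrite -sqrtrM // -[leLHS]ger0_norm ?addr_ge0 ?mulr_ge0 // -sqrtr_sqr.
  by rewrite ler_wsqrtr //; have := sqr_ge0 (a * d - b * c); nra.
rewrite -[leRHS]ger0_norm ?addr_ge0 ?sqrtr_ge0 // -sqrtr_sqr ler_wsqrtr //.
by rewrite sqrrD !sqr_sqrtr //; nra.
Qed.

Lemma dsum_nr_eq0 (x : dsum) : dsum_nr x = 0 -> x = 0.
Proof.
move=> h; have [h1 h2] := dsum_nr_ge x; rewrite h in h1 h2.
rewrite [x]surjective_pairing.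
have -> : x.1 = 0 by apply: nr_eq0; apply: le_anti; rewrite h1 nr_ge0.
by have -> : x.2 = 0 by apply: nr_eq0; apply: le_anti; rewrite h2 nr_ge0.
Qed.

Lemma dsum_nrZ (k : R[i]) (x : dsum) :
  (dsum_nr (k *: x))%:C = `|k| * (dsum_nr x)%:C.
Proof.
rewrite /dsum_nr /= !nrZC !exprMn -mulrDr sqrtrM ?sqr_ge0 // sqrtr_sqr.
have h : (complex.Re `|k|)%:C = `|k| by rewrite RRe_real ?normr_real.
have k0 : 0 <= complex.Re `|k| by rewrite -ler0c h.
by rewrite ger0_norm // -[in RHS]h -rmorphM.
Qed.

Lemma dsum_nrDC (x y : dsum) :
  (dsum_nr (x + y))%:C <= (dsum_nr x)%:C + (dsum_nr y)%:C :> R[i].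
Proof. by rewrite -rmorphD lecR dsum_nrD. Qed.

HB.instance Definition _ := @Lmodule_isNormed.Build R[i] dsum
  (fun x => (dsum_nr x)%:C)
  dsum_nrDC
  dsum_nrZ
  (fun x h => dsum_nr_eq0 (complexI h)).

Lemma dsum_normE (x : dsum) : `|x| = (dsum_nr x)%:C.
Proof. by []. Qed.

(** Both coordinate projections are contractions, so the coordinates converge; the sum of the
    coordinate norms dominates [dsum_nr]. *)
Lemma dsum_complete (F : set_system dsum) : ProperFilter F -> cauchy F -> cvg F.
Proof.
move=> FF /cauchy_ballP cF.
have cvg_of (p : dsum -> H) :
    (forall x y, p (x - y) = p x - p y) -> (forall x, nr (p x) <= dsum_nr x) ->
    cvg (p x @[x --> F])%classic.
  move=> pB pn; apply/cauchy_cvgP/cauchy_ballP => e e0; near_simpl.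
  apply: filterS (cF e e0) => -[x y]; rewrite -!ball_normE /= => h.
  apply: le_lt_trans h.
  by rewrite -pB !normE dsum_normE lecR.
have c1 := cvg_of fst (fun _ _ => erefl) (fun x => (dsum_nr_ge x).1).
have c2 := cvg_of snd (fun _ _ => erefl) (fun x => (dsum_nr_ge x).2).
apply/cvg_ex; exists ((lim (fst x @[x --> F]), lim (snd x @[x --> F]))%classic
  : dsum).
apply/cvgrPdist_lt => e e0.
have e2 : 0 < e / 2 by rewrite divr_gt0.
move/cvgrPdist_lt : c1 => /(_ _ e2) h1; move/cvgrPdist_lt : c2 => /(_ _ e2) h2.
near=> x.
rewrite dsum_normE; apply: le_lt_trans (_ :
  (nr (lim (fst x @[x --> F])%classic - x.1) + nr (lim (snd x @[x -->
  F])%classic - x.2))%:C < _).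
  by rewrite lecR; exact: dsum_nr_le.
rewrite rmorphD /= -!normE (splitr e) ltrD //; near: x; [exact: h1|exact: h2].
Unshelve. all: by end_near. Qed.

HB.instance Definition _ := Uniform_isComplete.Build dsum dsum_complete.

Lemma dsum_dot_norm (x : dsum) : dsum_dot x x = `|x| ^+ 2.
Proof.
rewrite dsum_dotxx dsum_normE -rmorphXn /= sqr_sqrtr //.
by rewrite addr_ge0 ?sqr_ge0.
Qed.

Definition hilbert_sum : hilbertType R :=
  @Hilbert R dsum dsum_dot dsum_dot_norm.

End DirectSum.

Section BlockOperators.
Context {R : realType} (H : hilbertType R).
Implicit Types (a b d : R).

Notation K := (hilbert_sum H).

Lemma rdot_sum (x y : K) : rdot x y = rdot (x : dsum H).1 (y : dsum H).1
  + rdot (x : dsum H).2 (y : dsum H).2.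
Proof. by rewrite /rdot /= raddfD. Qed.

(** The symmetric scalar matrix [[[a, b], [b, d]]] tensored with the identity of [H]. *)
Definition block_op a b d (x : K) : K :=
  (a%:C *: (x : dsum H).1 + b%:C *: (x : dsum H).2,
   b%:C *: (x : dsum H).1 + d%:C *: (x : dsum H).2) : dsum H.

Lemma sop_block_op a b d : sop (block_op a b d).
Proof.
have lin (p q : R) (k : R[i]) (u v w z : H) :
    p%:C *: (k *: u + v) + q%:C *: (k *: w + z)
    = k *: (p%:C *: u + q%:C *: w) + (p%:C *: v + q%:C *: z).
  rewrite !scalerDr !scalerA ![k * _]mulrC.
  by rewrite addrACA.
split.
- by move=> k x y; rewrite /block_op /= !lin.
- exists ((`|a| + `|b|) + (`|b| + `|d|)) => x.
  have [h1 h2] := dsum_nr_ge (x : dsum H).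
  have part p q : nr (p%:C *: (x : dsum H).1 + q%:C *: (x : dsum H).2)
      <= (`|p| + `|q|) * dsum_nr (x : dsum H).
    by rewrite (le_trans (nrD _ _)) // !nrZ mulrDl lerD // ler_wpM2l.
  rewrite [leLHS]/(dsum_nr (block_op a b d x :
    dsum H)) (le_trans (dsum_nr_le _)) //.
  by rewrite [leRHS]mulrDl lerD //; exact: part.
- by move=> x y; rewrite !rdot_sum /= !rdotE; ring.
Qed.

Lemma block_op_form a b d (x : K) : rdot (block_op a b d x) x =
  a * rdot (x : dsum H).1 (x : dsum H).1
  + 2 * b * rdot (x : dsum H).1 (x : dsum H).2
  + d * rdot (x : dsum H).2 (x : dsum H).2.
Proof.
rewrite rdot_sum /= !rdotE (rdotC (x : dsum H).2 (x : dsum H).1); ring.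
Qed.

Lemma block_op_diag_pos a d : 0 < a -> 0 < d -> pos_inv_op (block_op a 0 d).
Proof.
move=> a0 d0; apply/pos_inv_opP; split; first exact: sop_block_op.
exists (Num.min a d) => [|x]; first by rewrite lt_min a0.
rewrite block_op_form rdot_sum mulr0 mul0r addr0 mulrDr.
by rewrite lerD // ler_wpM2r ?rdotxx_ge0 // ge_min lexx ?orbT.
Qed.

End BlockOperators.

(** * Scalar properties of the representing function *)

Section RepresentingFunction.
Context {R : realType} (H : hilbertType R).
Variables (x0 : H) (sigma : mean_operation R) (f : R -> R).
Hypotheses (x0n0 : x0 != 0) (hsigma : operator_mean sigma)
  (hf : representing_function sigma f).
Implicit Types (s t m M d : R).

Lemma rdotx0_gt0 : 0 < rdot x0 x0.
Proof. by rewrite rdotxx exprn_gt0 // nr_gt0. Qed.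

Lemma repr_fun_gt0 t : 0 < t -> 0 < f t.
Proof.
move=> t0; have := mean_pos_inv (hsigma H) pos_inv_id (pos_inv_scale_id t0).
rewrite hf // => /pos_inv_opP[_ [c c0 /(_ x0)]]; rewrite fctE rdotZl.
rewrite ler_pM2r ?rdotx0_gt0 //; exact: lt_le_trans.
Qed.

Lemma repr_fun_mono s t : 0 < s -> s <= t -> f s <= f t.
Proof.
move=> s0 st; have t0 := lt_le_trans s0 st.
have st' : ple (s%:C *: idfun : H -> H) (t%:C *: idfun).
  by move=> x; rewrite !fctE !rdotZl ler_wpM2r ?rdotxx_ge0.
have := mean_ple (hsigma H) pos_inv_id (pos_inv_scale_id s0) pos_inv_id
  (pos_inv_scale_id t0) (fun x => lexx _) st' x0.
by rewrite !hf // !fctE !rdotZl ler_pM2r ?rdotx0_gt0.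
Qed.

(* Conjugate [diag(m, M)] by a reflection; the image is dominated by a diagonal
   operator whose first entry is arbitrarily close to a given convex
   combination of [m] and [M]. *)
Lemma repr_fun_concave m M c s d : 0 < m -> 0 < M -> c ^+ 2 + s ^+ 2 = 1 ->
  0 < d ->
  c ^+ 2 * f m + s ^+ 2 * f M <= f (c ^+ 2 * m + s ^+ 2 * M + d).
Proof.
move=> m0 M0 cs1 d0.
pose K := hilbert_sum H.
pose P : K -> K := block_op 1 0 0.
pose U : K -> K := block_op c s (- c).
pose X : K -> K := block_op m 0 M.
set t := c ^+ 2 * m + s ^+ 2 * M.
(* [w] is the off-diagonal entry of [U X U], whose first entry is [t]. The slack [d] in the first
   entry and [w^2 / d] in the second absorb it, which gives [U X U <= Z]. *)
pose w := c * s * (m - M).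
pose L := m + M + w ^+ 2 / d.
pose Z : K -> K := block_op (t + d) 0 L.
have t0 : 0 <= t by rewrite addr_ge0 // mulr_ge0 ?sqr_ge0 ?ltW.
have L0 : 0 < L by rewrite ltr_wpDr ?addr_gt0 // divr_ge0 ?sqr_ge0 ?ltW.
have td0 : 0 < t + d by rewrite ltr_wpDl.
have hP : sop P by exact: sop_block_op.
have hU : sop U by exact: sop_block_op.
have hX : pos_inv_op X by exact: block_op_diag_pos.
have hZ : pos_inv_op Z by exact: block_op_diag_pos.
have PE (x : K) : P x = (((x : dsum H).1, 0) : dsum H) :> K.
  by rewrite /P /block_op !scale0r scale1r !addr0.
have pP : proj_op P by split=> // x; rewrite !PE.
have cP a b : commutes P (block_op a 0 b : K -> K).
  by move=> x; rewrite !PE /block_op /= !scale0r !scaler0 !addr0.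
have UU x : U (U x) = x.
  have e (p q : H) : (c%:C *: (c%:C *: p + s%:C *: q) + s%:C *: (s%:C *:
    p + (- c)%:C *: q),
    s%:C *: (c%:C *: p + s%:C *: q) + (- c)%:C *: (s%:C *: p + (- c)%:C *:
      q)) = (p, q).
    congr pair; apply: rdot_inj => z; rewrite !rdotE.
      by transitivity ((c ^+ 2 + s ^+ 2) * rdot p z); [ring|rewrite cs1 mul1r].
    by transitivity ((c ^+ 2 + s ^+ 2) * rdot q z); [ring|rewrite cs1 mul1r].
  rewrite [RHS](surjective_pairing (x : dsum H)); exact: e.
have hY := pos_inv_conj hU hU UU hX.
have YZ : ple (U \o X \o U) Z.
  move=> x; rewrite /= (sopS _ _ hU) !block_op_form /=.
  set p := (x : dsum H).1; set q := (x : dsum H).2.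
  rewrite !rdotE (rdotC q p).
  have := rdotxx_ge0 (d%:C *: p - w%:C *: q); rewrite !rdotE (rdotC q p) => h.
  have q0 := rdotxx_ge0 q.
  have h1 : 2 * w * rdot p q <= d * rdot p p + w ^+ 2 / d * rdot q q.
    rewrite -(ler_pM2l d0) mulrDr.
    have -> : d * (w ^+ 2 / d * rdot q q) = w ^+ 2 * rdot q q by field;
      rewrite gt_eqF.
    by move: h; lra.
  have h2 : (m * s ^+ 2 + M * c ^+ 2) * rdot q q <= (m + M) * rdot q q.
    rewrite ler_wpM2r // lerD // -[leRHS]mulr1 ler_pM2l //
      -cs1 ?lerDl ?lerDr sqr_ge0 //.
  rewrite /L [_ * rdot q q in leRHS]mulrDl /t; move: h1 h2; rewrite /w; nra.
pose x : K := ((x0, 0) : dsum H).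
have Px : P x = x by rewrite PE.
have hsK := hsigma K.
have hfK := hf K.
have up : rdot (sigma idfun (U \o X \o U) x) x <= f (t + d) * rdot x x.
  apply: le_trans (mean_ple hsK pos_inv_id hY pos_inv_id hZ (fun y => lexx _)
    YZ x) _.
  rewrite -{1 2 3 4}Px; apply: (mean_le_on hsK hfK hZ pP (cP _ _) td0) => y.
  by rewrite PE block_op_form rdot_sum /= !rdot0r !mulr0 !addr0.
have eU : U \o idfun \o U = idfun by apply/funext => y; exact: UU.
(* The mean of the identity and [U X U] is [U F U], so its form at [x] is that of [F] at
   [y = U x = (c x0, s x0)]. *)
have := mean_congruence hsK hU hU UU UU pos_inv_id hX.
rewrite eU => e; rewrite e /= (sopS _ _ hU) in up.
set F := sigma idfun X in up; set y := U x in up.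
have hF : sop F by apply: (mean_sop hsK) => //; exact: pos_inv_id.
have cF : commutes P F by apply: (mean_commutes hsK hX pP); exact: cP.
(* [X] is [m] on the first coordinate and [M] on the second, so [F] is at least [f m] and [f M]
   there. *)
rewrite (rdot_proj_split y pP hF cF) in up.
have yE : y = ((c%:C *: x0, s%:C *: x0) : dsum H) :> K.
  by rewrite /y /U /block_op /= !scaler0 !addr0.
have lo1 : f m * rdot (P y) (P y) <= rdot (F (P y)) (P y).
  apply: (mean_ge_on hsK hfK hX pP (cP _ _) m0) => z.
  by rewrite PE block_op_form rdot_sum /= !rdot0r !mulr0 !addr0.
have QE z : (idfun - P) z = ((0, (z : dsum H).2) : dsum H) :> K.
  rewrite -[LHS]/(z - P z) PE; rewrite [X in X - _](surjective_pairing (z :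
    dsum H)).
  by rewrite -[LHS]/((_ - _, _ - _) : dsum H) subrr subr0.
have lo2 : f M * rdot ((idfun - P) y) ((idfun - P) y) <= rdot (F ((idfun - P)
  y)) ((idfun - P) y).
  apply: (mean_ge_on hsK hfK hX (proj_compl pP) _ M0) => z.
    by rewrite -[LHS]/(X z - P (X z)) -[RHS]/(X (z - P z)) cP (sopB _ _
      (pos_inv_sop hX)).
  by rewrite QE block_op_form rdot_sum /= !rdot0l !mulr0 !add0r.
have := le_trans (lerD lo1 lo2) up.
rewrite QE PE yE !rdot_sum /= !rdot0r !addr0 !add0r !rdotZl !rdotZr.
have e1 : f m * (c * (c * rdot x0 x0)) + f M * (s * (s * rdot x0 x0))
  = (c ^+ 2 * f m + s ^+ 2 * f M) * rdot x0 x0 by ring.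
by rewrite e1 ler_pM2r // rdotx0_gt0.
Qed.

End RepresentingFunction.

(** * The two inequalities *)

Section ScalarFunctions.
Context {R : realType}.
Implicit Types (s t m M d : R) (f h : R -> R).

Definition monotone_pos f : Prop := forall s t, 0 < s -> s <= t -> f s <= f t.

(** Says that [f t / t] is nonincreasing; for positive [f] this is monotonicity of [t / f t], the
    representing function of the dual. *)
Definition sublinear_pos f : Prop :=
  forall s t, 0 < s -> s <= t -> f t <= t / s * f s.

(** [f] increases while [f t / t] decreases, so near [t] the difference quotients stay below
    [2 f t / t]. *)
Lemma continuous_pos f t : (forall s, 0 < s -> 0 < f s) -> monotone_pos f ->
  sublinear_pos f -> 0 < t -> {for t, continuous f}.
Proof.
move=> f0 fm fs t0; apply/cvgrPdist_lt => e e0.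
have ft0 := f0 t t0.
have near_t d : 0 < d -> \forall x \near t, `|t - x| < d.
  by move=> d0; apply/nbhs_ballP; exists d => //= y; rewrite -ball_normE.
have c0 : 0 < 2 * (f t / t) by rewrite mulr_gt0 // divr_gt0.
near=> x.
have xt : `|t - x| < t / 2 by near: x; apply: near_t; rewrite divr_gt0.
have xe : `|t - x| < e / (2 * (f t / t)).
  by near: x; apply: near_t; rewrite divr_gt0.
move: xe; rewrite ltr_pdivlMr // => xe; apply: le_lt_trans xe.
have x2 : t / 2 < x by move: xt; rewrite ltr_norml => /andP[_]; lra.
have x0 : 0 < x by apply: lt_trans x2; rewrite divr_gt0.
have [tx|xt'] := leP t x.
  have := fs t x t0 tx; have := fm t x t0 tx.
  rewrite [`|t - x|]ler0_norm ?subr_le0 // => h1 h2;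
    rewrite ler0_norm ?subr_le0 // !opprB.
  apply: le_trans (_ : (x - t) * (f t / t) <= _).
    by rewrite (_ : _ * _ = x / t * f t - f t) ?lerB //; field; rewrite gt_eqF.
  by rewrite ler_wpM2l ?subr_ge0 // ler_peMl ?divr_ge0 ?ltW // ltr1n.
have {}xt' := ltW xt'.
have := fs x t x0 xt'; have := fm x t x0 xt' => h1 h2.
rewrite [`|t - x|]ger0_norm ?subr_ge0 // ger0_norm ?subr_ge0 //.
apply: le_trans (_ : (t - x) * (f x / x) <= _).
  by rewrite (_ : _ * _ = t / x * f x - f x) ?lerB //; field; rewrite gt_eqF.
rewrite ler_wpM2l ?subr_ge0 // mulrA [2 * _]mulrC -mulrA; apply: ler_pM => //.
- exact/ltW/f0.
- by rewrite invr_ge0 ltW.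
- by rewrite -[2](invrK) -invfM lef_pV2 ?posrE ?mulr_gt0 // ?invr_gt0 // ltW //
    mulrC.
Unshelve. all: by end_near. Qed.

(** The extreme value theorem ensures that [max_on] is a true maximum and not the default [0]. *)
Lemma le_max_on m M h t : m <= M ->
  (forall x, m <= x <= M -> {for x, continuous h}) ->
  m <= t <= M -> h t <= max_on m M h.
Proof.
move=> mM ch tmM.
have [|c + hc] := @EVT_max R h m M mM.
  by apply: continuous_in_subspaceT => x; rewrite inE /= in_itv; exact: ch.
rewrite in_itv /= => cmM.
rewrite /max_on; case: xgetP => [y _ [_ hy]|/(_ (h c))[]]; first exact: hy.
by split=> [|x xmM]; [exists c|apply: hc; rewrite in_itv].
Qed.

Section Chord.
Variables (m M : R) (f : R -> R).
Hypotheses (m0 : 0 < m) (mM : m < M) (f0 : forall s, 0 < s -> 0 < f s)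
  (fm : monotone_pos f) (fs : sublinear_pos f).

Let M0 : 0 < M. Proof. exact: lt_trans mM. Qed.

Lemma mu_ge0 : 0 <= mu_ m M f.
Proof. by rewrite divr_ge0 // subr_ge0 ?fm // ltW. Qed.

Lemma nu_ge0 : 0 <= nu_ m M f.
Proof.
rewrite divr_ge0 // subr_ge0; last exact: ltW.
rewrite mulrC -ler_pdivlMr // mulrAC; apply: fs => //; exact: ltW.
Qed.

(** Both coefficients are nonnegative, and not both zero because the chord equals [f m > 0] at
    [m]. *)
Lemma chord_gt0 t : 0 < t -> 0 < mu_ m M f * t + nu_ m M f.
Proof.
move=> t0; have := mu_ge0; have := nu_ge0;
  rewrite le_eqVlt => /orP[/eqP e|nu0 mu0].
  rewrite -e addr0 le_eqVlt => /orP[/eqP e'|mu0]; last by rewrite mulr_gt0.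
  have : f m = mu_ m M f * m + nu_ m M f.
    by rewrite /mu_ /nu_; field; rewrite subr_eq0 gt_eqF.
  by rewrite -e -e' mul0r addr0 => fm0; have := f0 m0; rewrite fm0 ltxx.
by rewrite ltr_wpDl // mulr_ge0 // ltW.
Qed.

Lemma chord_le t :
  (forall c s d, c ^+ 2 + s ^+ 2 = 1 -> 0 < d ->
     c ^+ 2 * f m + s ^+ 2 * f M <= f (c ^+ 2 * m + s ^+ 2 * M + d)) ->
  m <= t <= M -> mu_ m M f * t + nu_ m M f <= f t.
Proof.
move=> fc /andP[mt tM].
have Mm0 : 0 < M - m by rewrite subr_gt0.
have t0 : 0 < t by exact: lt_le_trans mt.
pose p := (M - t) / (M - m); pose q := (t - m) / (M - m).
have p0 : 0 <= p by rewrite divr_ge0 ?subr_ge0 // ltW.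
have q0 : 0 <= q by rewrite divr_ge0 ?subr_ge0 // ltW.
have pq : p + q = 1 by rewrite /p /q; field; rewrite gt_eqF.
apply/ler_addgt0Pr => e e0.
have ft0 := f0 t0.
(* Chosen so that sublinearity gives [f (t + d) <= f t + e], which removes the slack in the
   concavity hypothesis. *)
have d0 : 0 < e * t / f t by rewrite divr_gt0 // mulr_gt0.
have := fc (Num.sqrt p) (Num.sqrt q) _ _ d0; rewrite !sqr_sqrtr // => /(_ pq).
have -> : p * m + q * M = t by rewrite /p /q; field; rewrite gt_eqF.
have -> : p * f m + q * f M = mu_ m M f * t + nu_ m M f.
  by rewrite /p /q /mu_ /nu_; field; rewrite gt_eqF.
move=> h; apply: le_trans h _.
apply: le_trans (fs t0 _) _; first by rewrite lerDl ltW.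
by rewrite le_eqVlt; apply/orP; left; apply/eqP; field; rewrite !gt_eqF.
Qed.

(** With the chord coefficients of [t / f t] in this form, [zeta_] is seen to be [gamma_] of the
    dual function. *)
Lemma mu_dual : mu_ m M (fun t => t / f t) = nu_ m M f / (f m * f M).
Proof.
have fm0 := f0 m0; have fM0 := f0 M0.
by rewrite /mu_ /nu_; field; rewrite !gt_eqF // subr_gt0.
Qed.

Lemma nu_dual : nu_ m M (fun t => t / f t) = M * m * mu_ m M f / (f m * f M).
Proof.
have fm0 := f0 m0; have fM0 := f0 M0.
by rewrite /mu_ /nu_; field; rewrite !gt_eqF // subr_gt0.
Qed.

(* The geometric mean of [m] and [M] is where the product of the two affine
   functions of [t], divided by [t], is least. *)
Lemma sqrt_gamma_zeta :
  Num.sqrt (f m * f M) <= Num.sqrt (gamma_ m M f * zeta_ m M f) *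
    (nu_ m M f + Num.sqrt (M * m) * mu_ m M f).
Proof.
set tau := Num.sqrt (M * m).
have tau2 : tau ^+ 2 = M * m by rewrite sqr_sqrtr // mulr_ge0 // ltW.
have tau0 : 0 < tau by rewrite sqrtr_gt0 mulr_gt0.
have mtM : m <= tau <= M.
  have sq (x : R) : 0 < x -> x = Num.sqrt (x * x).
    by move=> x0; rewrite -expr2 sqrtr_sqr gtr0_norm.
  rewrite (sq m m0) (sq M M0) !ler_wsqrtr ?mulr_ge0 ?(ltW m0) ?(ltW M0) //.
    by rewrite ler_wpM2l // ltW.
  by rewrite ler_wpM2r // ltW.
have pos x : m <= x <= M -> 0 < x by case/andP => /(lt_le_trans m0).
have cf x : m <= x <= M -> {for x, continuous f}.
  by move=> /pos; exact: continuous_pos.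
have caff (p q x : R) : {for x, continuous (fun t : R => p * t + q)}.
  apply: continuousD; last exact: cst_continuous.
  by apply: continuousM; [exact: cst_continuous|exact: cvg_id].
have fM0 := f0 M0; have fm0 := f0 m0; have ft0 := f0 tau0.
set l := nu_ m M f + tau * mu_ m M f.
have lE : mu_ m M f * tau + nu_ m M f = l by rewrite addrC mulrC.
have l0 : 0 < l by rewrite -lE chord_gt0.
have aff2 x : 0 < x -> 0 < nu_ m M f * x + M * m * mu_ m M f.
  move=> x0.
  have -> : nu_ m M f * x + M * m * mu_ m M f
      = x * (mu_ m M f * (M * m / x) + nu_ m M f) by field; rewrite gt_eqF.
  by rewrite mulr_gt0 // chord_gt0 // divr_gt0 ?mulr_gt0.
(* Lower bounds for the two maxima from their values at [tau], where both affine functions reduce to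
   [l] because [tau^2 = M m]. *)
have g1 : f tau / l <= gamma_ m M f.
  rewrite -lE; apply: (@le_max_on m M (fun t => f t / (mu_ m M f * t + nu_ m M
    f))) => //.
    exact: ltW.
  move=> x xmM; apply: cvgM; first exact: cf.
  by apply: cvgV; [rewrite gt_eqF // chord_gt0 // pos|exact: caff].
have z1 : f M * f m / (f tau * l) <= zeta_ m M f.
  have -> : f M * f m / (f tau * l)
      = f M * f m * tau / (f tau * (nu_ m M f * tau + M * m * mu_ m M f)).
    have -> : nu_ m M f * tau + M * m * mu_ m M f = tau * l.
      by rewrite -tau2 /l; ring.
    by field; rewrite !gt_eqF.
  apply: (@le_max_on m M (fun t => f M * f m * t / (f t * (nu_ m M f * t + M *
    m * mu_ m M f)))) => //.
    exact: ltW.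
  move=> x xmM; apply: cvgM.
    by apply: cvgM; [exact: cvg_cst|exact: cvg_id].
  apply: cvgV; first by rewrite gt_eqF // mulr_gt0 ?f0 ?aff2 ?pos.
  by apply: cvgM; [exact: cf|exact: caff].
(* The value [f tau] cancels in the product. *)
have gz : f m * f M / l ^+ 2 <= gamma_ m M f * zeta_ m M f.
  apply: le_trans (ler_pM _ _ g1 z1); last 2 first.
  - by rewrite divr_ge0 // ltW.
  - by rewrite divr_ge0 // ltW // mulr_gt0.
  by rewrite le_eqVlt; apply/orP; left; apply/eqP; field; rewrite !gt_eqF.
rewrite -ler_pdivrMr // -[leLHS in leLHS <= _](_ :
  Num.sqrt (f m * f M / l ^+ 2) = _).
  exact: ler_wsqrtr.
rewrite sqrtrM ?mulr_ge0 ?(ltW fm0) ?(ltW fM0) // sqrtrV ?sqr_ge0 //.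
by rewrite sqrtr_sqr gtr0_norm.
Qed.

(** Expand [(sqrt t - al f t) (be f t - sqrt t) >= 0] and divide by [f t]. *)
Lemma dual_sqrt_le t (al := Num.sqrt (m / (f m * f M)))
    (be := Num.sqrt (M / (f m * f M))) : m <= t <= M ->
  al * be * f t + t / f t <= (al + be) * Num.sqrt t.
Proof.
move=> /andP[mt tM].
have t0 : 0 < t by exact: lt_le_trans mt.
have fM0 := f0 M0; have fm0 := f0 m0; have ft0 := f0 t0.
have md0 : 0 < m / (f m * f M) by rewrite divr_gt0 ?mulr_gt0.
have Md0 : 0 < M / (f m * f M) by rewrite divr_gt0 ?mulr_gt0.
(* After squaring, this is the product of [m f t <= t f m] (sublinearity) and [f t <= f M]
   (monotonicity); [be_ge] is symmetric. *)
have al_le : al * f t <= Num.sqrt t.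
  rewrite -[f t](gtr0_norm ft0) -sqrtr_sqr -sqrtrM ?(ltW md0) // ler_wsqrtr //
    mulrAC ler_pdivrMr ?mulr_gt0 // expr2.
  have h1 : m * f t <= t * f m.
    by have := fs m0 mt; rewrite mulrAC ler_pdivlMr // mulrC.
  rewrite [leLHS]mulrA [leRHS]mulrA; apply: ler_pM => //; last exact: fm.
    by rewrite mulr_ge0 // ltW.
  exact: ltW.
have be_ge : Num.sqrt t <= be * f t.
  rewrite -[f t](gtr0_norm ft0) -sqrtr_sqr -sqrtrM ?(ltW Md0) // ler_wsqrtr //
    [leRHS]mulrAC ler_pdivlMr ?mulr_gt0 // expr2.
  have h1 : t * f M <= M * f t.
    by have := fs t0 tM; rewrite mulrAC ler_pdivlMr // mulrC.
  rewrite [f m * _]mulrC [leLHS]mulrA [leRHS]mulrA; apply: ler_pM => //;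
    last exact: fm.
    by rewrite mulr_ge0 // ltW.
  exact: ltW.
have st : Num.sqrt t * Num.sqrt t = t by rewrite -expr2 sqr_sqrtr // ltW.
have h : 0 <= (Num.sqrt t - al * f t) * (be * f t - Num.sqrt t).
  by rewrite mulr_ge0 // subr_ge0.
rewrite -(ler_pM2r ft0) mulrDl divfK ?gt_eqF //.
by rewrite -[X in _ + X]st; move: h; lra.
Qed.

End Chord.
End ScalarFunctions.

(** * Linear bounds for one pair of operators *)

Section PairInequalities.
Context {R : realType} {H : hilbertType R}.
Variables (m M : R) (A B : H -> H).
Hypotheses (m0 : 0 < m) (mM : m < M) (hA : pos_inv_op A) (hB : pos_inv_op B)
  (mAB : ple (m%:C *: A) B) (MAB : ple B (M%:C *: A)).

Lemma whitened_bounds S V : sop S -> sop V -> (forall x, S (V x) = x) ->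
  (forall x, S (S x) = A x) -> bounds_on (V \o B \o V) idfun m M.
Proof.
move=> hS hV SV SS x /=; rewrite (sopS _ _ hV).
have e : rdot (A (V x)) (V x) = rdot x x by rewrite -SS (sopS _ _ hS) SV.
have := mAB (V x); have := MAB (V x).
by rewrite !fctE !rdotZl e => -> ->.
Qed.

(** [represents_le] applied to the whitened operator [V B V], then congruence by [S]. Nonnegative
    coefficients give the affine function the growth condition required there. *)
Lemma mean_ge_affine (sigma : (H -> H) -> (H -> H) -> H -> H) (f : R -> R) p q :
  operator_mean_on sigma ->
  (forall t, 0 < t -> sigma idfun (t%:C *: idfun) = (f t)%:C *: idfun) ->
  0 <= p -> 0 <= q -> (forall t, m <= t <= M -> p * t + q <= f t) ->
  ple (p%:C *: B + q%:C *: A) (sigma A B).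
Proof.
move=> hs hf p0 q0 pqf.
have [S [V [_ [[hS hV SV VS SS] _]]]] := geom_mean_factor hA hB.
have bE := whitened_bounds hS hV SV SS.
have hE := pos_inv_conj hV hS SV hB.
rewrite (mean_factor hs hA hB hS hV SV VS SS).
have h : ple (p%:C *: (V \o B \o V) + q%:C *:
  idfun) (sigma idfun (V \o B \o V)).
  apply: (represents_le (pos_inv_sop hE) m0 (ltW mM) bE
    (phi := fun t => p * t + q * 1) (psi := f)).
  - apply: represents_add; apply: represents_scale => //.
      exact: represents_self (pos_inv_sop hE).
    exact: represents_id.
  - exact: represents_mean.
  - move=> t tmM; apply: le_trans (pqf t tmM).
    by rewrite addr_ge0 // mulr_ge0 // (le_trans (ltW m0)) //; case/andP: tmM.
  - by move=> t tmM; rewrite mulr1 pqf.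
  - move=> s t s0 st; rewrite mulr1 mulrDr mulrCA divfK ?gt_eqF //.
    by rewrite lerD2l ler_peMl // ler_pdivlMr // mul1r.
move=> x; have := h (S x); rewrite !fctE /= !rdotDl !rdotZl !VS.
by rewrite (sopS (B x) _ hV) VS -!(sopS _ x hS) SS.
Qed.

(** Same transfer, with the means on the smaller side and the square root of [V B V] on the larger;
    the growth condition is now sublinearity of [f] and [g]. *)
Lemma geom_mean_ge (sigma tau : (H -> H) -> (H -> H) -> H -> H)
    (f g : R -> R) p q :
  operator_mean_on sigma -> operator_mean_on tau ->
  (forall t, 0 < t -> sigma idfun (t%:C *: idfun) = (f t)%:C *: idfun) ->
  (forall t, 0 < t -> tau idfun (t%:C *: idfun) = (g t)%:C *: idfun) ->
  0 <= p -> 0 <= q -> sublinear_pos f -> sublinear_pos g ->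
  (forall t, m <= t <= M -> p * f t + q * g t <= Num.sqrt t) ->
  ple (p%:C *: sigma A B + q%:C *: tau A B) (geom_mean A B).
Proof.
move=> hs ht hf hg p0 q0 fs gs pq.
have [S [V [r [[hS hV SV VS SS] [hr pr rr ->]]]]] := geom_mean_factor hA hB.
have bE := whitened_bounds hS hV SV SS.
have hE := pos_inv_conj hV hS SV hB.
rewrite (mean_factor hs hA hB hS hV SV VS SS) (mean_factor ht hA hB hS hV SV VS
  SS).
set E := V \o B \o V in bE hE *.
have rE : r = op_sqrt E.
  have [h1 h2 h3] := op_sqrtP (pos_inv_sop hE) (pos_inv_psd hE).
  by apply: sqrt_unique => // x; rewrite rr h3.
have h : ple (p%:C *: sigma idfun E + q%:C *: tau idfun E) r.
  rewrite rE; apply: (represents_le (pos_inv_sop hE) m0 (ltW mM) bE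
    (phi := fun t => p * f t + q * g t) (psi := Num.sqrt)).
  - by apply: represents_add; apply: represents_scale => //;
      exact: represents_mean.
  - exact: represents_sqrt (pos_inv_sop hE) (pos_inv_psd hE).
  - by move=> t _; exact: sqrtr_ge0.
  - exact: pq.
  - move=> s t s0 st; rewrite mulrDr ![t / s * (_ * _)]mulrCA.
    by rewrite lerD // ler_wpM2l // ?fs ?gs.
move=> x; have := h (S x); rewrite !fctE /= !rdotDl !rdotZl.
by rewrite -!(sopS _ x hS).
Qed.

End PairInequalities.

Section Sums.
Context {R : realType} {H : hilbertType R}.

Lemma rdot_sumop n (T : 'I_n -> H -> H) x y :
  rdot ((\sum_(j < n) T j) x) y = \sum_(j < n) rdot (T j x) y.
Proof.
elim/big_rec2: _ => [|j p q _ IH];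
  first by rewrite -[(0 : H -> H) x]/(0 : H) rdot0l.
by rewrite fctE rdotDl -IH.
Qed.

Lemma pos_inv_sum n (T : 'I_n -> H -> H) :
  (0 < n)%N -> (forall j, pos_inv_op (T j)) ->
  pos_inv_op (\sum_(j < n) T j).
Proof.
case: n T => // k T _ hT; apply: (pos_inv_ge (hT ord0)).
  by apply: sop_sum => j; exact: pos_inv_sop.
move=> x; rewrite rdot_sumop big_ord_recl lerDl sumr_ge0 // => j _.
exact: pos_inv_psd.
Qed.

Lemma ple_sum2 n (S1 S2 T : 'I_n -> H -> H) (p q : R) :
  (forall j, ple (p%:C *: S1 j + q%:C *: S2 j) (T j)) ->
  ple (p%:C *: (\sum_(j < n) S1 j) + q%:C *: (\sum_(j < n) S2 j))
      (\sum_(j < n) T j).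
Proof.
move=> h x; rewrite fctE rdotDl !fctE !rdotZl !rdot_sumop !mulr_sumr -big_split
  /=.
by apply: ler_sum => j _; have := h j x; rewrite fctE rdotDl !fctE !rdotZl.
Qed.

End Sums.

(** * Geometric means compared through operator matrices *)

Section BlockInequalities.
Context {R : realType} {H : hilbertType R}.
Variables (X Y : H -> H).
Hypotheses (hX : pos_inv_op X) (hY : pos_inv_op Y).

(** With [G] the mean of [A] and [B], add the block forms of [[[A, G], [G, B]]] and [[[B, G],
    [G, A]]] at rescaled vectors. The diagonal is dominated by [X] and [Y], and maximality of their
    mean bounds the off-diagonal term. *)
Lemma geom_mean_cross A B (p q p' q' : R) :
  pos_inv_op A -> pos_inv_op B ->
  0 <= p -> 0 <= q -> 0 <= p' -> 0 <= q' ->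
  ple (p%:C *: B + q%:C *: A) X -> ple (p'%:C *: B + q'%:C *: A) Y ->
  ple ((Num.sqrt q * Num.sqrt p' + Num.sqrt p * Num.sqrt q')%:C *:
    geom_mean A B)
      (geom_mean X Y).
Proof.
move=> hA hB p0 q0 p0' q0' hBX hBY; have hG := sop_geom_mean hA hB.
apply: geom_mean_max => //; first exact: sop_scale.
move=> u v; have bAB := psd_block_geom_mean hA hB.
have h1 := bAB ((Num.sqrt q)%:C *: u) ((Num.sqrt p')%:C *: v).
have h2 := psd_block_sym hG bAB ((Num.sqrt p)%:C *: u) ((Num.sqrt q')%:C *: v).
have := hBX u; have := hBY v; move: h1 h2.
rewrite !(sopZ _ _ (pos_inv_sop hA)) !(sopZ _ _ (pos_inv_sop hB)) !(sopZ _ _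
  hG).
rewrite !fctE !rdotDl !rdotZl !rdotZr.
have sq (c : R) x : 0 <= c -> Num.sqrt c * (Num.sqrt c * x) = c * x.
  by move=> c0; rewrite mulrA -expr2 sqr_sqrtr.
rewrite !sq //; lra.
Qed.

(** The block form of [X], [Y] and their mean, at [- sqrt p x] and [sqrt q x]. *)
Lemma geom_mean_amgm (p q : R) : 0 <= p -> 0 <= q ->
  ple ((2 * (Num.sqrt p * Num.sqrt q))%:C *: geom_mean X Y)
      (p%:C *: X + q%:C *: Y).
Proof.
move=> p0 q0 x; have hG := sop_geom_mean hX hY.
have := psd_block_geom_mean hX hY (- (Num.sqrt p)%:C *: x) ((Num.sqrt q)%:C *:
  x).
have sq (c : R) y : 0 <= c -> Num.sqrt c * (Num.sqrt c * y) = c * y.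
  by move=> c0; rewrite mulrA -expr2 sqr_sqrtr.
rewrite scaleNr (sopN _ (pos_inv_sop hX)) (sopZ _ _ (pos_inv_sop hX)).
rewrite (sopZ _ _ (pos_inv_sop hY)) (sopZ _ _ hG) !rdotE opprK !sq //.
lra.
Qed.

End BlockInequalities.

(** * Summation over the pairs and comparison of constants *)

Theorem theorem2p2 (R : realType) (H : hilbertType R) (m M : R)
    (hm : 0 < m) (hmM : m < M) (n : nat) (hn : (0 < n)%N)
    (A B : 'I_n -> H -> H)
    (hA : forall j, pos_inv_op (A j)) (hB : forall j, pos_inv_op (B j))
    (hmAB : forall j, op_le (m%:C *: A j) (B j))
    (hMAB : forall j, op_le (B j) (M%:C *: A j))
    (sigma sigma_dual : mean_operation R) (f : R -> R)
    (hsigma : operator_mean sigma) (hf : representing_function sigma f)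
    (hdual : is_dual_mean sigma_dual f) :
  op_le
    (geom_mean (\sum_(j < n) A j) (\sum_(j < n) B j))
    ((Num.sqrt (gamma_ m M f * zeta_ m M f))%:C *:
       geom_mean (\sum_(j < n) sigma H (A j) (B j))
                 (\sum_(j < n) sigma_dual H (A j) (B j)))
  /\
  op_le
    (geom_mean (\sum_(j < n) sigma H (A j) (B j))
               (\sum_(j < n) sigma_dual H (A j) (B j)))
    (((Num.sqrt M + Num.sqrt m) / (2 * Num.sqrt (Num.sqrt (M * m))))%:C *:
       \sum_(j < n) geom_mean (A j) (B j)).
Proof.
(* On the zero space nothing can be read off about [f], but both inequalities are trivial; otherwise
   a nonzero vector gives access to scalars. *)
have [H0|/existsNP[x0 /eqP x0n0]] := pselect (forall x : H, x = 0).
  by split=> x; rewrite [X in hdot H _ X]H0 linear0r.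
have [hdual_mean hg] := hdual.
pose g t := t / f t.
have M0 : 0 < M by exact: lt_trans hmM.
have f0 := repr_fun_gt0 x0n0 hsigma hf.
have g0 := repr_fun_gt0 x0n0 hdual_mean hg.
have fm : monotone_pos f := repr_fun_mono x0n0 hsigma hf.
have gm : monotone_pos g := repr_fun_mono x0n0 hdual_mean hg.
(* Sublinearity of each of [f] and [g = t / f t] is monotonicity of the other. *)
have fs : sublinear_pos f.
  move=> s t s0 st; have t0 := lt_le_trans s0 st.
  have := gm s t s0 st; rewrite /g ler_pdivrMr ?f0 // mulrAC ler_pdivlMr ?f0 //.
  by rewrite mulrAC ler_pdivlMr // mulrC.
have gs : sublinear_pos g.
  move=> s t s0 st; have t0 := lt_le_trans s0 st.
  rewrite /g mulrA divfK ?gt_eqF //.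
  by rewrite ler_pM2l // lef_pV2 ?posrE ?f0 // fm.
have fch := chord_le hm hmM f0 fs (fun c s d cs => repr_fun_concave x0n0 hsigma
  hf hm M0 cs).
have gch := chord_le hm hmM g0 gs (fun c s d cs => repr_fun_concave x0n0
  hdual_mean hg hm M0 cs).
have mAB j : ple (m%:C *: A j) (B j).
  by apply/pleP => //; [apply: sop_scale|]; exact: pos_inv_sop.
have MAB j : ple (B j) (M%:C *: A j).
  by apply/pleP => //; [|apply: sop_scale]; exact: pos_inv_sop.
set a := \sum_(j < n) A j; set b := \sum_(j < n) B j.
set X := \sum_(j < n) sigma H (A j) (B j).
set Y := \sum_(j < n) sigma_dual H (A j) (B j).
have ha : pos_inv_op a by exact: pos_inv_sum.
have hb : pos_inv_op b by exact: pos_inv_sum.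
have hX : pos_inv_op X by apply: pos_inv_sum => // j;
  exact: (mean_pos_inv (hsigma H)).
have hY : pos_inv_op Y by apply: pos_inv_sum => // j;
  exact: (mean_pos_inv (hdual_mean H)).
have hXY := sop_geom_mean hX hY; have pXY := psd_geom_mean hX hY.
have hab := sop_geom_mean ha hb; have pab := psd_geom_mean ha hb.
have fm0 := f0 m hm; have fM0 := f0 M M0.
have ab0 : 0 < f m * f M by rewrite mulr_gt0.
have mu0 := mu_ge0 hm hmM fm.
have nu0 := nu_ge0 hm hmM fs.
split.
  apply/pleP => //; first exact: sop_scale.
  have hlX : ple ((mu_ m M f)%:C *: b + (nu_ m M f)%:C *: a) X.
    by apply: ple_sum2 => j; exact: (mean_ge_affine hm hmM (hA j) (hB j) (mAB
      j) (MAB j) (hsigma H) (hf H) mu0 nu0 fch).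
  have mg0 := mu_ge0 hm hmM gm; have ng0 := nu_ge0 hm hmM gs.
  have hlY : ple ((mu_ m M g)%:C *: b + (nu_ m M g)%:C *: a) Y.
    by apply: ple_sum2 => j; exact: (mean_ge_affine hm hmM (hA j) (hB j) (mAB
      j) (MAB j) (hdual_mean H) (hg H) mg0 ng0 gch).
  have := geom_mean_cross hX hY ha hb mu0 nu0 mg0 ng0 hlX hlY.
  rewrite mu_dual // nu_dual //.
  have sz := sqrt_gamma_zeta hm hmM f0 fm fs.
  (* The coefficient delivered by [geom_mean_cross] for the chords of [f] and of its dual. *)
  set k := (_ + _ : R).
  have kE : k * Num.sqrt (f m * f M) = nu_ m M f + Num.sqrt (M * m) * mu_ m M f.
    have sab : Num.sqrt (f m * f M) != 0 by rewrite gt_eqF // sqrtr_gt0.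
    have e1 : Num.sqrt (nu_ m M f / (f m * f M))
        = Num.sqrt (nu_ m M f) / Num.sqrt (f m * f M).
      by rewrite sqrtrM // sqrtrV // ltW.
    have e2 : Num.sqrt (M * m * mu_ m M f / (f m * f M))
        = Num.sqrt (M * m) * Num.sqrt (mu_ m M f) / Num.sqrt (f m * f M).
      have Mm : 0 <= M * m by rewrite mulr_ge0 // ltW.
      have Mmmu : 0 <= M * m * mu_ m M f by rewrite mulr_ge0.
      by rewrite (sqrtrM _ Mmmu) sqrtrV ?(ltW ab0) // (sqrtrM _ Mm).
    rewrite /k e1 e2.
    rewrite -[X in _ = X + _](sqr_sqrtr nu0) -[X in _ = _ + _ * X](sqr_sqrtr
      mu0).
    by field.
  (* Cancelling [sqrt (f m f M)] turns [sz] into [1 <= sqrt (gamma zeta) k]. *)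
  rewrite -kE mulrA ler_pMl ?sqrtr_gt0 // in sz.
  move=> h x; have := h x; rewrite !fctE !rdotZl => hx.
  have k0 : 0 <= Num.sqrt (gamma_ m M f * zeta_ m M f) by exact: sqrtr_ge0.
  apply: le_trans (ler_wpM2l k0 hx); rewrite mulrA.
  by rewrite ler_peMl // pab.
have hW : sop (\sum_(j < n) geom_mean (A j) (B j)).
  by apply: sop_sum => j; exact: sop_geom_mean.
apply/pleP => //; first exact: sop_scale.
set r := Num.sqrt (f m * f M).
pose al := Num.sqrt (m / (f m * f M)); pose be := Num.sqrt (M / (f m * f M)).
have r0 : 0 < r by rewrite sqrtr_gt0.
have sm0 : 0 < Num.sqrt m by rewrite sqrtr_gt0.
have sM0 : 0 < Num.sqrt M by rewrite sqrtr_gt0.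
have rr0 : 0 < Num.sqrt (Num.sqrt (M * m)) by rewrite !sqrtr_gt0 mulr_gt0.
have alE : al = Num.sqrt m / r by rewrite /al sqrtrM ?(ltW hm) // sqrtrV // ltW.
have beE : be = Num.sqrt M / r by rewrite /be sqrtrM ?(ltW M0) // sqrtrV // ltW.
have al0 : 0 < al by rewrite alE divr_gt0.
have be0 : 0 < be by rewrite beE divr_gt0.
have s0 : 0 < al + be by rewrite addr_gt0.
(* The coefficients of [dual_sqrt_le], normalized so that the right-hand side is [sqrt t]. *)
pose p := al * be / (al + be); pose q := (al + be)^-1.
have p0 : 0 <= p by rewrite divr_ge0 ?mulr_ge0 // ltW.
have q0 : 0 <= q by rewrite invr_ge0 ltW.
have pq t : m <= t <= M -> p * f t + q * g t <= Num.sqrt t.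
  move=> tmM; rewrite -(ler_pM2l s0); apply:
    le_trans (dual_sqrt_le hm hmM f0 fm fs tmM).
  by rewrite le_eqVlt /p /q -/al -/be -[t / f t]/(g t); apply/orP; left;
    apply/eqP; field; rewrite gt_eqF.
have hXYW : ple (p%:C *: X + q%:C *: Y) (\sum_(j < n) geom_mean (A j) (B j)).
  apply: ple_sum2 => j.
  exact: (geom_mean_ge hm hmM (hA j) (hB j) (mAB j) (MAB j) (hsigma H)
    (hdual_mean H) (hf H) (hg H) p0 q0 fs gs pq).
(* Twice this product, the coefficient in [geom_mean_amgm], is the reciprocal of the constant of the
   statement. *)
have spq : Num.sqrt p * Num.sqrt q
    = Num.sqrt (Num.sqrt (M * m)) / (Num.sqrt M + Num.sqrt m).
  rewrite -sqrtrM // /p /q.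
  have -> : al * be / (al + be) * (al + be)^-1
      = Num.sqrt (M * m) / (Num.sqrt M + Num.sqrt m) ^+ 2.
    rewrite alE beE sqrtrM ?(ltW M0) //; field.
    by rewrite !gt_eqF // ?addr_gt0 // -?mulrDl.
  by rewrite sqrtrM ?sqrtr_ge0 // sqrtrV ?sqr_ge0 // sqrtr_sqr gtr0_norm //
    addr_gt0.
move=> x; have := le_trans (geom_mean_amgm hX hY p0 q0 x) (hXYW x).
rewrite !fctE !rdotZl spq => h.
set c := _ / (2 * _).
have c0 : 0 <= c by rewrite divr_ge0 ?mulr_ge0 ?addr_ge0 // ltW.
apply: le_trans (ler_wpM2l c0 h).
by rewrite le_eqVlt /c; apply/orP; left; apply/eqP; field; rewrite !gt_eqF //
  addr_gt0.
Qed.
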